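(* Let $\beta\in S_n$ have cycle type $(c_1,\dots,c_n)$. Then \[ c(4,\beta)=c([4],\beta)+c([3,1],\beta)+c([2,2],\beta)+c([2,1,1],\beta), \] where \begin{align*} c([4],\beta)&=|C_{S_n}(\beta)|\sum_{i\ge4}c_i\binom{i}{4},\\ c([3,1],\beta)&=|C_{S_n}(\beta)|\sum_{i\ge1,\ j\ge i+2}ij(j-i-1)c_ic_j,\\ c([2,2],\beta)&=|C_{S_n}(\beta)|\Big(\sum_{i\ge2}i\binom{i}{2}\binom{c_i}{2}+\sum_{j>i\ge2}i(i-1)j\,c_ic_j\Big),\\ c([2,1,1],\beta)&=|C_{S_n}(\beta)|\Big(\sum_{i\ge1}i^3c_{2i}\binom{c_i}{2}+\sum_{j>i\ge1}ij(i+j)c_ic_jc_{i+j}\Big). \end{align*}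
   Context: $S_n$ is the symmetric group on $[n]$, products composed right to left. The cycle type $(c_1,\dots,c_n)$ means $\beta$ has exactly $c_i$ cycles of length $i$ (fixed points counted as $1$-cycles), with $c_i=0$ for $i>n$. $C_{S_n}(\beta)$ is the centralizer of $\beta$. A point $a$ is a bad commuting point of $\alpha,\beta$ if $\alpha\beta(a)\ne\beta\alpha(a)$; $\alpha$ $k$-commutes with $\beta$ if there are exactly $k$ bad commuting points, and $c(k,\beta)$ is the number of $\alpha\in S_n$ that $k$-commute with $\beta$. For an unordered integer partition $[k_1,\dots,k_h]$ of $k$ with all $k_i\ge1$, $c([k_1,\dots,k_h],\beta)$ is the number of $\alpha\in S_n$ that $k$-commute with $\beta$ such that the bad commuting points lie in exactly $h$ cycles $\beta_1,\dots,\beta_h$ of $\beta$, with $\beta_i$ containing exactly $k_i$ of them. *)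

(* Defs.v *)
From mathcomp Require Import all_boot all_fingroup.

Set Implicit Arguments.
Unset Strict Implicit.
Unset Printing Implicit Defensive.

(* Mathcomp composes permutations left to right, (s * t) a = t (s a), so the
   right-to-left products are written out as nested applications: "alpha beta"
   sends a to alpha (beta a). *)

(* The cycles of beta are identified with their underlying sets, the elements
   of [porbits beta]; fixed points are singleton cycles. *)
Definition has_cycle_type (n : nat) (beta : 'S_n) (c : nat -> nat) : Prop :=
  (forall i, 1 <= i <= n -> c i = #|[set B in porbits beta | #|B| == i]|)
  /\ (forall i, n < i -> c i = 0).

Definition bad_points (n : nat) (alpha beta : 'S_n) : {set 'I_n} :=
  [set a | alpha (beta a) != beta (alpha a)].

Definition k_commutes (n k : nat) (alpha beta : 'S_n) : bool :=
  #|bad_points alpha beta| == k.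

(* c(k, beta) *)
Definition num_k_commuting (n k : nat) (beta : 'S_n) : nat :=
  #|[set alpha : 'S_n | k_commutes k alpha beta]|.

(* For each cycle of beta containing a bad commuting point, the number of bad
   commuting points in it; the order of the list is irrelevant. *)
Definition bad_distribution (n : nat) (alpha beta : 'S_n) : seq nat :=
  [seq #|bad_points alpha beta :&: B|
     | B <- enum (porbits beta) & bad_points alpha beta :&: B != set0].

(* c([k_1, ..., k_h], beta), for ks a list of positive integers read as an
   unordered partition of its sum. *)
Definition num_part_commuting (n : nat) (ks : seq nat) (beta : 'S_n) : nat :=
  #|[set alpha : 'S_n | k_commutes (sumn ks) alpha beta
                        && perm_eq (bad_distribution alpha beta) ks]|.

(* Main.v *)
Require Import Defs.
From mathcomp Require Import all_boot all_fingroup.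
From mathcomp Require Import zify.

(* Write beta' for the conjugate alpha^-1 beta alpha.  The bad commuting points
   are those where beta' and beta differ, and each conjugate arises from
   |C(beta)| permutations alpha, so everything reduces to counting conjugates
   beta' = beta sigma with sigma moving exactly four points.  Such a sigma is
   even, hence equals (a b)(c d), and it comes from eight tuples (a, b, c, d).
   Multiplying by a transposition splits a cycle or merges two; as the number
   of cycles must be preserved, one of (a b), (c d) splits and the other merges,
   and the cycle type is preserved exactly when the lengths of the two pieces
   produced by the split are the lengths of the two pieces merged.  Reading off
   these lengths in each distribution of a, b, c, d among the cycles of beta
   gives the four sums. *)

Set Implicit Arguments.
Unset Strict Implicit.
Unset Printing Implicit Defensive.

(** * Splitting and merging cycles by a transposition *)

Section Porbit.
Variable T : finType.
Implicit Types (s t : {perm T}) (x y z : T).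
Local Open Scope group_scope.

(** The eight tuples of one sigma come from exchanging [a] and [b], exchanging [c] and [d], and
    exchanging the two pairs. As disjoint transpositions commute, either may be performed first, and
    this freedom puts each distribution in a normal form. For [4], [3,1] and [2,1,1] the points [c],
    [d] are taken in one cycle, so the split comes first and its pieces are read off inside a cycle
    of beta. For [2,2] no pair may lie in a single cycle, so the merge must come first and the split
    is measured inside the merged cycle. The distribution [1,1,1,1] never occurs, since both
    transpositions would merge. Ordered tuples are summed rather than sets of points because, once
    two points are fixed, the choices for the others depend only on lengths; a sum over points of a
    function of the cycle length then becomes a sum over lengths i with weight i c_i. The number of
    rearranged normal forms times the constant in front of each tuple sum is always eight. *)

Lemma porbit_expP s x y :
  y \in porbit s x -> exists2 i, i < #|porbit s x| & y = (s ^+ i) x.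
Proof.
by rewrite porbit_traject => /trajectP[i lti ->]; exists i; rewrite ?permX.
Qed.

Lemma porbit_exp_inj s x i j : i < #|porbit s x| -> j < #|porbit s x| ->
  (s ^+ i) x = (s ^+ j) x -> i = j.
Proof.
move=> lti ltj; rewrite !permX -(nth_traject _ lti) -(nth_traject _ ltj).
by move/eqP; rewrite nth_uniq ?size_traject ?uniq_traject_porbit // => /eqP.
Qed.

Lemma exp_porbit s x : (s ^+ #|porbit s x|) x = x.
Proof. by rewrite permX iter_porbit. Qed.

Lemma exp_porbit_mod s x i : (s ^+ (i %% #|porbit s x|)) x = (s ^+ i) x.
Proof.
rewrite {2}(divn_eq i #|porbit s x|) expgD permM; congr ((s ^+ _) _).
elim: (_ %/ _) => [|m IHm]; first by rewrite mul0n expg0 perm1.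
by rewrite mulSn expgD permM exp_porbit.
Qed.

Lemma eq_exp_porbit s x i j :
  ((s ^+ i) x == (s ^+ j) x) = (i == j %[mod #|porbit s x|]).
Proof.
have Lgt0: 0 < #|porbit s x| by rewrite lt0n card_porbit_neq0.
apply/eqP/eqP=> [|eq_ij]; last by rewrite -exp_porbit_mod eq_ij exp_porbit_mod.
rewrite -(exp_porbit_mod _ _ i) -(exp_porbit_mod _ _ j).
by apply: porbit_exp_inj; rewrite ltn_mod.
Qed.

Lemma porbit_step s x : porbit s (s x) = porbit s x.
Proof. by have := porbit_perm s 1 x; rewrite expg1. Qed.

Lemma porbit_sub_closed s x (A : {set T}) :
  x \in A -> {in A, forall z, s z \in A} -> porbit s x \subset A.
Proof.
move=> xA sA; apply/subsetP=> _ /porbitP[i ->].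
elim: i => [|i IHi]; first by rewrite expg0 perm1.
by rewrite expgSr permM sA.
Qed.

Lemma porbit_mul_tpermD s x y z : z \notin porbit s x -> z \notin porbit s y ->
  porbit (tperm x y * s) z = porbit s z.
Proof.
move=> zx zy; apply/porbit_setP=> u.
suffices exp_id n: ((tperm x y * s) ^+ n) z = (s ^+ n) z.
  by apply/porbitP/porbitP=> -[i ->]; exists i; rewrite exp_id.
elim: n => // n IHn; rewrite !expgSr !permM IHn tpermD //.
  by apply: contraNneq zx => ->; rewrite porbit_sym mem_porbit.
by apply: contraNneq zy => ->; rewrite porbit_sym mem_porbit.
Qed.

(** Each multiplication by the transposition changes the number of cycles by one, and two of them
    give back [s]; so exactly one of the two steps is a split, and membership flips. *)
Lemma mem_porbit_mul_tperm s x y : x != y ->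
  (y \in porbit (tperm x y * s) x) = (y \notin porbit s x).
Proof.
move=> ne_xy; have := porbits_mul_tperm (tperm x y * s) x y.
have := porbits_mul_tperm s x y; rewrite /= tpermKg ne_xy.
rewrite ![x \in _]porbit_sym.
by case: (y \in _); case: (y \in _) => //=; lia.
Qed.

(** The first step sends [(s ^+ k) x] to [x] and then to [s x]; the points [(s ^+ j) x] with
    [0 < j < k] avoid both transposed points, so from there the product follows [s]. *)
Lemma exp_mul_tperm s x k j : k < #|porbit s x| -> 0 < j <= k ->
  ((tperm x ((s ^+ k) x) * s) ^+ j) ((s ^+ k) x) = (s ^+ j) x.
Proof.
move=> ltk /andP[]; case: j => // j _; elim: j => [|j IHj] ltj.
  by rewrite !expg1 permM tpermR.
rewrite expgSr permM IHj 1?ltnW // permM tpermD -?permM -?expgSr //.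
  apply/eqP=> eqx; suff: 0 = j.+1 by [].
  by apply: (@porbit_exp_inj s x); rewrite ?expg0 ?perm1 //; lia.
apply/eqP=> eqx; suff: k = j.+1 by lia.
by apply: (@porbit_exp_inj s x); rewrite //; lia.
Qed.

(** The point returns after [k] steps, and an earlier return would make two distinct powers of [s]
    below the cycle length agree at [x]. *)
Lemma card_porbit_split s x k : 0 < k < #|porbit s x| ->
  #|porbit (tperm x ((s ^+ k) x) * s) ((s ^+ k) x)| = k.
Proof.
move=> /andP[k_gt0 ltk]; set y := (s ^+ k) x; set t := _ * s.
have tk: (t ^+ k) y = y by rewrite exp_mul_tperm // k_gt0 /=.
have L_gt0: 0 < #|porbit t y| by rewrite lt0n card_porbit_neq0.
have /eqP: (t ^+ k) y == (t ^+ 0) y by rewrite tk expg0 perm1.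
move/eqP; rewrite eq_exp_porbit mod0n => kL.
have leL: #|porbit t y| <= k by apply: dvdn_leq.
apply/eqP; rewrite eqn_leq leL /=.
suff: #|porbit t y| = k by move=> ->.
apply: (@porbit_exp_inj s x) => //; first by lia.
by rewrite -(exp_mul_tperm ltk) ?L_gt0 // exp_porbit.
Qed.

Lemma card_porbit_splitl s x k : 0 < k < #|porbit s x| ->
  #|porbit (tperm x ((s ^+ k) x) * s) x| = #|porbit s x| - k.
Proof.
move=> /andP[k_gt0 ltk]; set y := (s ^+ k) x.
have xy: x = (s ^+ (#|porbit s x| - k)) y.
  by rewrite -permM -expgD subnKC ?exp_porbit // ltnW.
have Ly: #|porbit s y| = #|porbit s x| by rewrite porbit_perm.
have := @card_porbit_split s y (#|porbit s x| - k).
by rewrite -xy tpermC Ly => ->; lia.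
Qed.

Lemma card_porbit_mul_tperm s x y : x != y -> y \in porbit s x ->
  #|porbit (tperm x y * s) x| + #|porbit (tperm x y * s) y| = #|porbit s x|.
Proof.
move=> ne_xy /porbit_expP[[|k] ltk def_y].
  by rewrite def_y expg0 perm1 eqxx in ne_xy.
by rewrite def_y card_porbit_split ?card_porbit_splitl ?subnK // ltnW.
Qed.

(** Both pieces stay inside the old cycle and are disjoint, and their sizes add up to its length. *)
Lemma porbit_split s x y : x != y -> y \in porbit s x ->
  porbit s x = porbit (tperm x y * s) x :|: porbit (tperm x y * s) y.
Proof.
move=> ne_xy yx; apply/esym/eqP; rewrite eqEcard cardsU.
have closed z: z \in porbit s x -> (tperm x y * s) z \in porbit s x.
  rewrite -!eq_porbit_mem permM porbit_step.
  by case: tpermP => // -> _; rewrite ?eq_porbit_mem ?porbit_id.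
rewrite subUset !porbit_sub_closed ?porbit_id //=.
rewrite card_porbit_mul_tperm // (_ : _ :&: _ = set0) ?cards0 ?subn0 //.
apply/setP=> z; rewrite !inE; apply/negbTE/negP=> /andP[].
rewrite -!eq_porbit_mem => /eqP-> ; rewrite eq_porbit_mem porbit_sym.
by rewrite mem_porbit_mul_tperm // yx.
Qed.

Definition block_sizes (P : {set {set T}}) : seq nat :=
  map (fun B : {set T} => #|B|) (enum P).

Definition ctype s := block_sizes (porbits s).

Lemma block_sizesD1 (P : {set {set T}}) (B : {set T}) : B \in P ->
  perm_eq (block_sizes P) (#|B| :: block_sizes (P :\ B)).
Proof.
move=> BP; rewrite /block_sizes -(map_cons (fun B : {set T} => #|B|)).
rewrite perm_map // uniq_perm ?enum_uniq //=.
  by rewrite enum_uniq mem_enum !inE eqxx.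
by move=> C; rewrite inE !mem_enum !inE; case: eqP => [->|].
Qed.


(** Stated with additions on both sides, so that nothing is removed from a multiset. Read with
    [tperm x y * s] as the starting permutation, it describes a merge. *)
Lemma ctype_split s x y : x != y -> y \in porbit s x ->
  perm_eq (#|porbit (tperm x y * s) x| :: #|porbit (tperm x y * s) y| :: ctype s)
          (#|porbit s x| :: ctype (tperm x y * s)).
Proof.
move=> ne_xy yx; set t := tperm x y * s.
have yNx: y \notin porbit t x by rewrite mem_porbit_mul_tperm // negbK.
have rest: porbits t :\ porbit t x :\ porbit t y = porbits s :\ porbit s x.
  apply/setP=> B; rewrite !inE; apply/and3P/andP=> [[By Bx]|[Bx]] /imsetP[z _ Bz].
    have zNx: z \notin porbit s x.
      rewrite (porbit_split ne_xy yx) inE -/t.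
      by rewrite -!eq_porbit_mem -Bz (negbTE By) (negbTE Bx).
    have defB: B = porbit s z.
      rewrite Bz porbit_mul_tpermD //.
      by move: yx; rewrite -eq_porbit_mem => /eqP->.
    by rewrite defB eq_porbit_mem zNx imset_f.
  have zNx: z \notin porbit s x by rewrite -eq_porbit_mem -Bz.
  have zNy: z \notin porbit s y.
    by move: yx; rewrite -eq_porbit_mem => /eqP->.
  have defB: B = porbit t z by rewrite porbit_mul_tpermD.
  move: zNx; rewrite (porbit_split ne_xy yx) inE -/t -!eq_porbit_mem -defB.
  by case/norP=> *; split=> //; rewrite defB imset_f.
have hs := block_sizesD1 (imset_f (porbit s) (erefl (x \in T))).
have ht := block_sizesD1 (imset_f (porbit t) (erefl (x \in T))).
have ht' : porbit t y \in porbits t :\ porbit t x.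
  by rewrite !inE imset_f // andbT eq_porbit_mem.
move/block_sizesD1: ht'; rewrite rest.
rewrite /ctype; move: hs ht; rewrite -/(porbits s) -/(porbits t).
move=> /seq.permP h1 /seq.permP h2 /seq.permP h3; apply/seq.permP=> p.
rewrite /= (h1 p) (h2 p) /= (h3 p) /= [RHS]addnCA; congr (_ + _).
exact: addnCA.
Qed.

End Porbit.

(** * Conjugacy and cycle type *)

Section Conjugacy.
Variable T : finType.
Implicit Types (s t : {perm T}) (x y z : T).
Local Open Scope group_scope.

Lemma porbitJ s (a : {perm T}) x : porbit (s ^ a) (a x) = a @: porbit s x.
Proof.
apply/setP=> y; apply/porbitP/imsetP=> [[i ->]|[_ /porbitP[i ->] ->]].
  by exists ((s ^+ i) x); rewrite ?mem_porbit // -conjXg permJ.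
by exists i; rewrite -conjXg permJ.
Qed.

Lemma ctypeJ s (a : {perm T}) : perm_eq (ctype (s ^ a)) (ctype s).
Proof.
pose f (B : {set T}) := a @: B.
have f_inj : injective f by apply: imset_inj; apply: perm_inj.
have defJ : porbits (s ^ a) = f @: porbits s.
  apply/setP=> B; apply/imsetP/imsetP=> [[x _ ->]|[_ /imsetP[x _ ->] ->]].
    exists (porbit s (a^-1 x)); rewrite ?imset_f //.
    by rewrite /f -porbitJ permKV.
  by exists (a x); rewrite // porbitJ.
have : perm_eq (enum (porbits (s ^ a))) (map f (enum (porbits s))).
  rewrite uniq_perm ?enum_uniq ?map_inj_uniq ?enum_uniq // => B.
  rewrite mem_enum defJ; apply/imsetP/mapP=> -[C]; last first.
    by rewrite mem_enum; exists C.
  by move=> CP ->; exists C; rewrite ?mem_enum.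
move/(perm_map (fun B : {set T} => #|B|)) => /perm_trans; apply.
rewrite -map_comp (eq_map (_ : _ =1 (fun B : {set T} => #|B|))) // => B /=.
by rewrite card_imset //; apply: perm_inj.
Qed.

(** Equality of the multisets of lengths only permutes positions in the two lists; carried over to
    the enumerations of cycles, that permutation pairs cycles of equal length. *)
Lemma ctype_matching s t : perm_eq (ctype s) (ctype t) ->
  exists f : {set T} -> {set T},
    {in porbits s, forall B, f B \in porbits t /\ #|f B| = #|B|}
    /\ {in porbits s &, injective f}.
Proof.
case/(perm_iotaP 0)=> Is; rewrite {1}/ctype /block_sizes size_map => pIs eq_st.
pose e := map (nth set0 (enum (porbits t))) Is.
have pe : perm_eq e (enum (porbits t)) by apply/(perm_iotaP set0); exists Is.
have sz_e : size e = size (enum (porbits s)).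
  by move/(congr1 size): eq_st; rewrite !size_map.
have card_e i : i < size e -> #|nth set0 e i| = #|nth set0 (enum (porbits s)) i|.
  move=> lti; move/(congr1 (nth 0 ^~ i)): eq_st.
  have ltI : i < size Is by rewrite size_map in lti.
  rewrite (nth_map set0) -?sz_e // (nth_map 0) // => ->.
  have lt2 : nth 0 Is i < size (enum (porbits t)).
    by have := mem_nth 0 ltI; rewrite (perm_mem pIs) mem_iota.
  by rewrite (nth_map set0) // (nth_map 0).
have index_lt B : B \in porbits s -> index B (enum (porbits s)) < size e.
  by move=> Bs; rewrite sz_e index_mem mem_enum.
exists (fun B => nth set0 e (index B (enum (porbits s)))); split=> [B Bs|B C Bs Cs].
  split; last by rewrite card_e ?index_lt // nth_index ?mem_enum.
  by rewrite -mem_enum -(perm_mem pe) mem_nth ?index_lt.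
move/eqP; rewrite nth_uniq ?index_lt // ?(perm_uniq pe) ?enum_uniq // => /eqP eqi.
by rewrite -[B](@nth_index _ set0 B (enum (porbits s))) ?eqi ?nth_index ?mem_enum.
Qed.

Lemma ctype_conj s t : perm_eq (ctype s) (ctype t) -> exists a, t = s ^ a.
Proof.
move/ctype_matching=> [f [f_porbit f_inj]].
(* Pair base points x, y of matched cycles and send s^k x to t^k y; this is well
   defined and injective because matched cycles have equal length. *)
have [x0 _|T0] := pickP (@predT T); last first.
  by exists 1; apply/permP=> z; have := T0 z.
(* A choice is required for every set; [(x0, x0)] is a dummy for those that are not cycles of
   [s]. *)
have /fin_all_exists[r rP] (B : {set T}) : exists xy : T * T,
    B \in porbits s -> B = porbit s xy.1 /\ f B = porbit t xy.2.
  have [Bs|] := boolP (B \in porbits s); last by exists (x0, x0).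
  have [/imsetP[y _ ->] _] := f_porbit B Bs.
  by case/imsetP: Bs => x _ ->; exists (x, y).
pose O z := porbit s z.
have Os z : O z \in porbits s by rewrite imset_f.
have /fin_all_exists[k kP] z : exists k, z = (s ^+ k) (r (O z)).1.
  by apply/porbitP; have [<- _] := rP _ (Os z); rewrite porbit_id.
pose a z := (t ^+ k z) (r (O z)).2.
have aE z j : z = (s ^+ j) (r (O z)).1 -> a z = (t ^+ j) (r (O z)).2.
  have [eO efO] := rP _ (Os z); have [_ cO] := f_porbit _ (Os z).
  rewrite {1}(kP z) => /eqP; rewrite eq_exp_porbit -eO -cO efO => eq_kj.
  by apply/eqP; rewrite eq_exp_porbit.
have porbit_a z : porbit t (a z) = f (O z).
  by rewrite porbit_perm; have [_ <-] := rP _ (Os z).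
have a_inj : injective a.
  move=> z z' eq_a; have [eO efO] := rP _ (Os z).
  have eqO : O z = O z' by apply: f_inj; rewrite ?Os // -!porbit_a eq_a.
  have [_ cO] := f_porbit _ (Os z).
  rewrite (kP z) (kP z') -eqO; apply/eqP; rewrite eq_exp_porbit -eO -cO efO.
  by rewrite -eq_exp_porbit; apply/eqP; rewrite -/(a z) eq_a /a eqO.
exists (perm a_inj); apply/permP=> w; rewrite -(permKV (perm a_inj) w).
move: (_ w) => z; rewrite permJ !permE /a -permM -expgSr.
have eO : O (s z) = O z by apply: porbit_step.
rewrite -/(a _) (aE _ (k z).+1) ?eO //.
by rewrite expgSr permM -kP.
Qed.

End Conjugacy.

(** The fibre of conjugation over [x ^ g] is the right coset of the centralizer through [g], so all
    fibres over the class have the same size. *)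
Lemma card_conj_fiber (gT : finGroupType) (x : gT) (P : pred gT) :
  #|[set a | P (x ^ a)%g]| = #|'C[x]%g| * #|[set y in (x ^: [set: gT])%g | P y]|.
Proof.
rewrite -sum1_card (partition_big (fun a => x ^ a)%g
  (mem [set y in (x ^: [set: gT])%g | P y])) /=; last first.
  by move=> a; rewrite !inE => Pa; rewrite memJ_class ?inE.
rewrite mulnC -sum_nat_const; apply: eq_bigr => y.
rewrite inE => /andP[/imsetP[g _ ->] Pg].
rewrite sum1_card -(card_rcoset _ g); apply: eq_card => a.
rewrite unfold_in /= inE mem_rcoset cent1E.
have -> : ((a * g^-1 * x)%g == (x * (a * g^-1))%g) = ((x ^ a)%g == (x ^ g)%g).
  rewrite -(inj_eq (mulgI (a * g^-1)^-1)%g) mulKg -/(x ^ (a * g^-1))%g conjgM.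
  by rewrite -(inj_eq (conjg_inj g)) conjgKV eq_sym.
case: eqP => [->|]; by rewrite ?Pg ?andbF.
Qed.

(** * Even permutations moving four points *)

Section DoubleTranspositions.
Variable T : finType.
Implicit Types (s t : {perm T}) (a b c d x y z : T).

Definition moved s : {set T} := [set z | s z != z].

Lemma moved_perm s z : (s z \in moved s) = (z \in moved s).
Proof. by rewrite !inE (inj_eq perm_inj). Qed.

Lemma moved_tperm2 a b c d : uniq [:: a; b; c; d] ->
  moved (tperm a b * tperm c d) =i [:: a; b; c; d].
Proof.
rewrite /= !inE !negb_or andbT => /and3P[/and3P[ab ac ad] /andP[bc bd] cd] z.
rewrite !inE permM; have [->|za|zb za] := tpermP a b.
- by rewrite tpermD 1?eq_sym // eqxx ab.
- by rewrite za tpermD 1?eq_sym // eqxx orbT eq_sym ab.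
move/eqP/negbTE: (zb) => ->; move/eqP/negbTE: za => -> /=.
have [->|->|zc zd] := tpermP c d.
- by rewrite eqxx eq_sym cd.
- by rewrite eqxx orbT cd.
by move/eqP/negbTE: zc => ->; move/eqP/negbTE: zd => ->; rewrite eqxx.
Qed.

(* The remaining derangements of four points are the 4-cycles, which are odd. *)
Lemma even_moved4_involutive s :
  ~~ odd_perm s -> #|moved s| = 4 -> involutive s.
Proof.
move=> even_s card_s x; apply/eqP/negPn/negP; set y := s x; set w := s y => wx.
have inj := inj_eq (@perm_inj _ s).
have yx : y != x by apply: contra_neq wx => yx; rewrite /w yx.
have wy : w != y by rewrite /w inj.
have xA : x \in moved s by rewrite inE.
have yA : y \in moved s by rewrite moved_perm.
have wA : w \in moved s by rewrite moved_perm.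
have /cards1P[v defA] : #|moved s :\ x :\ y :\ w| == 1.
  move: card_s; rewrite (cardsD1 x) xA (cardsD1 y) !in_setD1 yx yA.
  by rewrite (cardsD1 w) !in_setD1 wy wx wA /= !add1n => -[->].
have AE z : (z \in moved s) = [|| z == x, z == y, z == w | z == v].
  have := congr1 (fun A : {set T} => z \in A) defA; rewrite /= !in_setD1 in_set1.
  have [->|zx] := eqVneq z x; first by rewrite xA.
  have [->|zy] := eqVneq z y; first by rewrite yA.
  by have [->|zw] := eqVneq z w; first by rewrite wA.
have /setP/(_ v) := defA; rewrite !in_setD1 set11 => /and4P[vw vy vx vA].
(* The alternative [s w = x] closes a 3-cycle and leaves [v] fixed, although [v] is moved. *)
have sw : s w = v.
  have swy : (s w == y) = false by rewrite inj (negbTE wx).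
  have sww : (s w == w) = false by rewrite inj (negbTE wy).
  have : s w \in moved s by rewrite moved_perm.
  rewrite AE swy sww /= => /orP[/eqP swx|/eqP //].
  have svx : (s v == x) = false by rewrite -swx inj (negbTE vw).
  have svy : (s v == y) = false by rewrite inj (negbTE vx).
  have svw : (s v == w) = false by rewrite inj (negbTE vy).
  have : s v \in moved s by rewrite moved_perm.
  by move: (vA); rewrite inE AE svx svy svw => /negbTE->.
have sv : s v = x.
  have svy : (s v == y) = false by rewrite inj (negbTE vx).
  have svw : (s v == w) = false by rewrite inj (negbTE vy).
  have : s v \in moved s by rewrite moved_perm.
  move: (vA); rewrite inE AE svy svw => /negbTE->.
  by rewrite !orbF => /eqP.
(* Now [s] is the 4-cycle through [x], [y], [w], [v]; three transpositions undo it, so it is odd. *)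
suff eq1 : (tperm x v * (tperm x w * (tperm x y * s)) = 1)%g.
  move: even_s; have := odd_perm1 T; rewrite -eq1 !odd_mul_tperm.
  by rewrite ![x == _]eq_sym wx yx vx; case: (odd_perm s).
apply/permP=> z; rewrite !permM perm1.
have [zA|] := boolP (z \in moved s); last first.
  move=> zA; have := zA; rewrite AE !negb_or => /and4P[zx zy zw zv].
  by rewrite !tpermD 1?eq_sym //; move: zA; rewrite inE negbK => /eqP.
move: zA; rewrite AE => /or4P[] /eqP ->.
- by rewrite tpermL (@tpermD _ x w v) 1?(@tpermD _ x y v) // eq_sym.
- by rewrite (@tpermD _ x v y) 1?(@tpermD _ x w y) ?tpermR // eq_sym.
- by rewrite (@tpermD _ x v w) 1?tpermR ?tpermL // eq_sym.
- by rewrite tpermR tpermL tpermD // eq_sym.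
Qed.

Lemma involutive_tperm2 s a c : involutive s -> #|moved s| = 4 ->
  a \in moved s -> c \in moved s :\ a :\ s a ->
  uniq [:: a; s a; c; s c] /\ s = (tperm a (s a) * tperm c (s c))%g.
Proof.
move=> sK card_s aA; rewrite !in_setD1 => /and3P[c_sa ca cA].
have sa : s a != a by rewrite inE in aA.
have sc : s c != c by rewrite inE in cA.
have sca : s c != a by rewrite -[a]sK (inj_eq perm_inj).
have scsa : s c != s a by rewrite (inj_eq perm_inj).
have Us : uniq [:: a; s a; c; s c].
  by rewrite /= !inE !negb_or; do !(apply/andP; split); rewrite // eq_sym.
split=> //; have mA : moved s =i [:: a; s a; c; s c].
  apply/fsym/subset_cardP; last first.
    by apply/subsetP=> z; rewrite !inE; case/or4P=> /eqP->; rewrite ?sK // eq_sym.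
  by rewrite card_s; apply/card_uniqP.
apply/permP=> z; have [|zA] := boolP (z \in moved s); last first.
  move: (zA); rewrite mA -(moved_tperm2 Us); rewrite !inE !negbK => /eqP->.
  by move: zA; rewrite inE negbK => /eqP.
rewrite mA !inE permM => /or4P[] /eqP->; rewrite ?sK.
- by rewrite tpermL tpermD // eq_sym.
- by rewrite tpermR tpermD // eq_sym.
- by rewrite (@tpermD _ a) 1?eq_sym // tpermL.
- by rewrite (@tpermD _ a) 1?eq_sym // tpermR.
Qed.

(** Four choices of [a] among the moved points, two of [c] outside [a] and [s a]; then [b = s a] and
    [d = s c] are forced. *)
Lemma sum_tperm2 s : involutive s -> #|moved s| = 4 ->
  \sum_a \sum_b \sum_c \sum_d
    (uniq [:: a; b; c; d] && (s == tperm a b * tperm c d)%g) = 8.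
Proof.
move=> sK card_s.
have condE a b c d : (uniq [:: a; b; c; d] && (s == tperm a b * tperm c d)%g)
   = [&& a \in moved s, b == s a, c \in moved s :\ a :\ s a & d == s c].
  apply/andP/and4P=> [[U /eqP sE]|[aA /eqP-> cA /eqP->]]; last first.
    by have [U sE] := involutive_tperm2 sK card_s aA cA; split=> //; apply/eqP.
  move: (U); rewrite /= !inE !negb_or andbT.
  move=> /and3P[/and3P[ab ac ad] /andP[bc bd] cd].
  have sab : s a = b by rewrite sE permM tpermL tpermD 1?eq_sym.
  have scd : s c = d by rewrite sE permM (@tpermD _ a b c) ?tpermL // eq_sym.
  rewrite sab scd; split; rewrite ?inE ?sab ?scd ?eqxx 1?eq_sym //.
  by rewrite bc eq_sym ac eq_sym cd.
transitivity (\sum_(a in moved s) \sum_(c in moved s :\ a :\ s a) 1).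
  rewrite [RHS]big_mkcond; apply: eq_bigr => a _.
  rewrite (bigD1 (s a)) //= addnC big1 => [|b /negbTE nb]; last first.
    by rewrite big1 // => c _; rewrite big1 // => d _; rewrite condE nb andbF.
  rewrite add0n; have [aA|aA] := boolP (a \in _); last first.
    by rewrite big1 // => c _; rewrite big1 // => d _; rewrite condE (negbTE aA).
  rewrite [RHS]big_mkcond; apply: eq_bigr => c _.
  rewrite (bigD1 (s c)) //= addnC big1 => [|d /negbTE nd].
    by rewrite condE aA !eqxx andbT; case: (c \in _).
  by rewrite condE nd !andbF.
have cardA a : a \in moved s -> #|moved s :\ a :\ s a| = 2.
  move=> aA; move: card_s; rewrite (cardsD1 a) aA (cardsD1 (s a)) in_setD1.
  by rewrite moved_perm aA; move: aA; rewrite inE => -> [].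
rewrite (eq_bigr (fun=> 2)) => [|a aA]; last by rewrite sum1_card cardA.
by rewrite sum_nat_const card_s.
Qed.

Variable s : {perm T}.

(* In right-to-left notation this is s (a b)(c d) when a, b, c, d are distinct. *)
Definition tperm2M a b c d : {perm T} := (tperm a b * (tperm c d * s))%g.

(** Booleans count as 0 or 1, so [sum4] of a condition counts tuples; the nested form lets variables
    be exchanged and summed one at a time. *)
Definition sum4 (F : T -> T -> T -> T -> nat) :=
  \sum_a \sum_b \sum_c \sum_d F a b c d.

Lemma sum4E F : sum4 F = \sum_(u : T * T * T * T) F u.1.1.1 u.1.1.2 u.1.2 u.2.
Proof.
rewrite /sum4 pair_bigA pair_bigA pair_bigA /=.
by apply: eq_bigr => -[[[]]].
Qed.

Lemma eq_sum4 F G : (forall a b c d, F a b c d = G a b c d) -> sum4 F = sum4 G.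
Proof. by move=> FG; rewrite !sum4E; apply: eq_bigr => u _; apply: FG. Qed.

Lemma sum4D F G :
  sum4 (fun a b c d => F a b c d + G a b c d) = sum4 F + sum4 G.
Proof. by rewrite !sum4E big_split. Qed.

Definition moved_by t : {set T} := [set z | t z != s z].

(** Double counting of pairs of a conjugate [t] and a tuple producing it: each [t] has eight tuples,
    each admissible tuple one [t]. *)
Lemma card_conj_moved4 (P : pred {perm T}) :
  8 * #|[set t in (s ^: [set: {perm T}])%g | (#|moved_by t| == 4) && P t]| =
  sum4 (fun a b c d => [&& uniq [:: a; b; c; d],
    tperm2M a b c d \in (s ^: [set: {perm T}])%g & P (tperm2M a b c d)]).
Proof.
set A := [set t in _ | _].
have moved_byE t : moved_by t = moved (t * s^-1).
  by apply/setP=> z; rewrite !inE permM (canF_eq (permKV s)) .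
have sum8 t : t \in A -> sum4 (fun a b c d => uniq [:: a; b; c; d]
                                 && (t == tperm2M a b c d)) = 8.
  rewrite !inE => /and3P[/imsetP[g _ def_t] /eqP card_t _].
  rewrite -(@sum_tperm2 (t * s^-1)%g); last by rewrite -moved_byE.
    apply: eq_sum4 => a b c d; congr (nat_of_bool (_ && _)).
    by rewrite -(inj_eq (mulIg s^-1)%g) /tperm2M !mulgA mulgK.
  (* Conjugates have the same sign, so [t * s^-1] is even. *)
  apply: even_moved4_involutive; last by rewrite -moved_byE.
  by rewrite odd_permM odd_permV def_t odd_permJ addbb.
have sumA a b c d : \sum_(t in A) (uniq [:: a; b; c; d] && (t == tperm2M a b c d))
    = [&& uniq [:: a; b; c; d], tperm2M a b c d \in (s ^: [set: {perm T}])%g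
        & P (tperm2M a b c d)].
  have [U|_] := boolP (uniq _); last by rewrite big1.
  set t := tperm2M _ _ _ _.
  have card_t : #|moved_by t| = 4.
    rewrite moved_byE /t /tperm2M !mulgA mulgK.
    by rewrite (eq_card (moved_tperm2 U)) (card_uniqP U).
  have tA : (t \in A) = (t \in (s ^: [set: {perm T}])%g) && P t.
    by rewrite inE card_t.
  rewrite !andTb -tA; have [tA'|tNA] := boolP (t \in A).
    by rewrite (bigD1 t) //= eqxx big1 // => t' /andP[_ /negbTE->].
  by rewrite big1 // => t' t'A; case: eqP => // eqt; rewrite -eqt t'A in tNA.
transitivity (\sum_(t in A) sum4 (fun a b c d =>
    uniq [:: a; b; c; d] && (t == tperm2M a b c d))).
  by rewrite mulnC -sum_nat_const; apply: eq_bigr => t /sum8.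
under eq_bigr do rewrite sum4E.
by rewrite exchange_big sum4E; apply: eq_bigr => -[[[a b] c] d] _; apply: sumA.
Qed.

End DoubleTranspositions.

(** * Conjugacy of beta (a b)(c d) with beta *)

Lemma perm_eq2 (X : eqType) (x y z w : X) :
  perm_eq [:: x; y] [:: z; w] = (x == z) && (y == w) || (x == w) && (y == z).
Proof.
apply/idP/orP=> [|[|] /andP[/eqP-> /eqP->] //]; last first.
  by rewrite (perm_catC [:: w] [:: z]).
move=> p; have := perm_mem p x; rewrite !inE eqxx /= => /esym/orP[]/eqP eqx.
  left; move: p; rewrite eqx eqxx perm_cons.
  by move/(@perm_small_eq _ _ [:: w] isT)=> -[->] /=.
right; move: p; rewrite eqx eqxx perm_sym (perm_catCA [:: z] [:: w] [::]) /=.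
by rewrite perm_cons => /(@perm_small_eq _ _ [:: y] isT) -[->] /=.
Qed.

(** The entry [p + q] exceeds both [p] and [q], so it must match [p' + q'], and the two sums
    cancel. *)
Lemma perm_eq_split_merge (p q p' q' : nat) : 0 < p -> 0 < q ->
  perm_eq [:: p; q; p' + q'] [:: p'; q'; p + q] = perm_eq [:: p; q] [:: p'; q'].
Proof.
move=> p_gt0 q_gt0; apply/idP/idP=> [eqp|]; last first.
  rewrite perm_eq2 => /orP[] /andP[/eqP-> /eqP->] //.
  rewrite [q' + p']addnC (perm_cat2r [:: p' + q'] [:: q'; p'] [:: p'; q']).
  by rewrite (perm_catC [:: q'] [:: p']).
have eq_sum : p + q = p' + q'.
  have := perm_mem eqp (p + q); rewrite !inE eqxx !orbT.
  by case/or3P=> /eqP; lia.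
move: eqp; rewrite eq_sum.
by rewrite (perm_cat2r [:: p' + q'] [:: p; q] [:: p'; q']).
Qed.

(** [C] and [C'] are the cycle types before and after, [U] the one in between, which cancels.
    Multisets are compared by counting each predicate, which leaves linear arithmetic. *)
Lemma split_merge_cancel (p q r p' q' r' : nat) (C C' U : seq nat) :
  perm_eq (p :: q :: C) (r :: U) -> perm_eq (p' :: q' :: C') (r' :: U) ->
  perm_eq C C' = perm_eq [:: p; q; r'] [:: p'; q'; r].
Proof.
move=> /seq.permP pu /seq.permP pv; apply/seq.permP/seq.permP=> eqp P;
  move: (pu P) (pv P) (eqp P) => /=;
  move: (nat_of_bool (P p)) (nat_of_bool (P q)) (nat_of_bool (P r))
        (nat_of_bool (P p')) (nat_of_bool (P q')) (nat_of_bool (P r'));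
  move: (count P C) (count P C') (count P U); clear; lia.
Qed.

Lemma merge_split_cancel (p q r p' q' r' : nat) (C C' U : seq nat) :
  perm_eq (p :: q :: U) (r :: C) -> perm_eq (p' :: q' :: U) (r' :: C') ->
  perm_eq C C' = perm_eq [:: p; q; r'] [:: p'; q'; r].
Proof.
move=> /seq.permP pu /seq.permP pv; apply/seq.permP/seq.permP=> eqp P;
  move: (pu P) (pv P) (eqp P) => /=;
  move: (nat_of_bool (P p)) (nat_of_bool (P q)) (nat_of_bool (P r))
        (nat_of_bool (P p')) (nat_of_bool (P q')) (nat_of_bool (P r'));
  move: (count P C) (count P C') (count P U); clear; lia.
Qed.

Section Criteria.
Variables (T : finType) (s : {perm T}).
Implicit Types (a b c d x y z : T).
Local Open Scope group_scope.

Lemma mem_class_ctype (t : {perm T}) :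
  (t \in s ^: [set: {perm T}]) = perm_eq (ctype s) (ctype t).
Proof.
apply/imsetP/idP=> [[g _ ->]|/ctype_conj[g ->]]; first by rewrite perm_sym ctypeJ.
by exists g; rewrite ?inE.
Qed.

Lemma size_ctype (t : {perm T}) : size (ctype t) = #|porbits t|.
Proof. by rewrite size_map cardE. Qed.

(** After the split by [c], [d], a second split would leave two cycles too many. The merge by [a],
    [b] is read backwards as a split of the final permutation, so both ends are compared with the
    intermediate [u]. *)
Lemma conj_split_merge a b c d : c != d -> d \in porbit s c -> a != b ->
  (tperm2M s a b c d \in s ^: [set: {perm T}]) =
    (b \notin porbit (tperm c d * s) a) &&
    perm_eq [:: #|porbit (tperm c d * s) c|; #|porbit (tperm c d * s) d|]
            [:: #|porbit (tperm c d * s) a|; #|porbit (tperm c d * s) b|].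
Proof.
move=> ne_cd dc ne_ab; rewrite mem_class_ctype /tperm2M.
set u := _ * s; set v := _ * u.
have pu := ctype_split ne_cd dc; have cu := card_porbit_mul_tperm ne_cd dc.
rewrite -/u in pu cu; have [ba|bNa] /= := boolP (b \in _).
  apply/negP=> /perm_size; rewrite !size_ctype => eq_size.
  have := porbits_mul_tperm s c d; have := porbits_mul_tperm u a b.
  rewrite /= -/u -/v (porbit_sym u a) (porbit_sym s c) ba dc ne_ab ne_cd.
  rewrite eq_size /=.
  by move: #|porbits u| #|porbits v|; clear; lia.
have defu : u = tperm a b * v by rewrite tpermKg.
have ba : b \in porbit v a by rewrite mem_porbit_mul_tperm.
have pv := ctype_split ne_ab ba; have cv := card_porbit_mul_tperm ne_ab ba.
rewrite -defu in pv cv; rewrite -perm_eq_split_merge ?lt0n ?card_porbit_neq0 //.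
by rewrite cu cv; exact: (split_merge_cancel pu pv).
Qed.

Lemma conj_merge_split a b c d : c != d -> d \notin porbit s c -> a != b ->
  (tperm2M s a b c d \in s ^: [set: {perm T}]) =
    (b \in porbit (tperm c d * s) a) &&
    perm_eq [:: #|porbit s c|; #|porbit s d|]
      [:: #|porbit (tperm2M s a b c d) a|; #|porbit (tperm2M s a b c d) b|].
Proof.
move=> ne_cd dNc ne_ab; rewrite mem_class_ctype /tperm2M.
set u := _ * s; set v := _ * u.
have defs : s = tperm c d * u by rewrite tpermKg.
have dc : d \in porbit u c by rewrite mem_porbit_mul_tperm.
have pu := ctype_split ne_cd dc; have cu := card_porbit_mul_tperm ne_cd dc.
rewrite -defs in pu cu; have [ba|bNa] /= := boolP (b \in _); last first.
  apply/negP=> /perm_size; rewrite !size_ctype => eq_size.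
  have := porbits_mul_tperm s c d; have := porbits_mul_tperm u a b.
  rewrite /= -/u -/v (porbit_sym u a) (porbit_sym s c).
  rewrite (negbTE bNa) (negbTE dNc) ne_ab ne_cd eq_size /=.
  by move: #|porbits u| #|porbits v|; clear; lia.
have pv := ctype_split ne_ab ba; have cv := card_porbit_mul_tperm ne_ab ba.
rewrite -/v in pv cv; rewrite -perm_eq_split_merge ?lt0n ?card_porbit_neq0 //.
by rewrite cu cv; exact: (merge_split_cancel pu pv).
Qed.

Lemma tperm2MC a b c d : uniq [:: a; b; c; d] ->
  tperm2M s a b c d = tperm2M s c d a b.
Proof.
rewrite /= !inE !negb_or => /and4P[/and3P[ab ac ad] /andP[bc bd] cd _].
rewrite /tperm2M !mulgA; congr (_ * _).
by rewrite conjgC tpermJ !tpermD // eq_sym.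
Qed.

End Criteria.

(** * Distribution of the bad points *)

Section Tally.
Variable X : eqType.
Implicit Types (A B C D : X) (l : seq X).

Definition tally_counts l := [seq count_mem B l | B <- undup l].

(** Only the six equality tests between the entries matter; truth values that violate transitivity
    are discarded by [congruence]. *)
Lemma tally_counts4 A B C D : let t := tally_counts [:: A; B; C; D] in
  [/\ perm_eq t [:: 4] = [&& A == B, B == C & C == D],
      perm_eq t [:: 3; 1] =
        [|| [&& A == C, C == D & A != B], [&& B == C, C == D & A != B],
            [&& A == B, B == C & C != D] | [&& A == B, B == D & C != D]],
      perm_eq t [:: 2; 2] =
        [|| [&& A == B, C == D & A != C], [&& A == C, B == D & A != B]
          | [&& A == D, B == C & A != B]]
    & perm_eq t [:: 2; 1; 1] =
        [|| [&& A == B, A != C, A != D & C != D],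
            [&& A == C, A != B, A != D & B != D],
            [&& A == D, A != B, A != C & B != C],
            [&& B == C, A != B, B != D & A != D],
            [&& B == D, A != B, B != C & A != C]
          | [&& C == D, A != C, B != C & A != B]]].
Proof.
rewrite /tally_counts /= !inE.
case EAB: (A == B); case EAC: (A == C); case EAD: (A == D);
case EBC: (B == C); case EBD: (B == D); case ECD: (C == D);
rewrite /= ?(eq_sym B A) ?(eq_sym C A) ?(eq_sym D A)
  ?(eq_sym C B) ?(eq_sym D B) ?(eq_sym D C)
  ?EAB ?EAC ?EAD ?EBC ?EBD ?ECD ?eqxx //;
exfalso; move/eqP: EAB; move/eqP: EAC; move/eqP: EAD;
move/eqP: EBC; move/eqP: EBD; move/eqP: ECD; congruence.
Qed.

End Tally.

Section Distribution.
Variables (n : nat) (s : 'S_n).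
Implicit Types (t : 'S_n) (a b c d x y z : 'I_n).

Definition distribution t : seq nat :=
  [seq #|moved_by s t :&: B|
     | B <- enum (porbits s) & moved_by s t :&: B != set0].

Lemma distribution_tperm2M a b c d : uniq [:: a; b; c; d] ->
  perm_eq (distribution (tperm2M s a b c d))
          (tally_counts (map (porbit s) [:: a; b; c; d])).
Proof.
move=> U; set l := [:: a; b; c; d] in U *.
pose M := moved_by s (tperm2M s a b c d).
have ME z : (z \in M) = (z \in l).
  rewrite -(moved_tperm2 U) !inE /tperm2M !permM.
  by rewrite (inj_eq perm_inj).
have cardM (B : {set 'I_n}) : B \in porbits s ->
    #|M :&: B| = count_mem B (map (porbit s) l).
  case/imsetP=> x _ ->; rewrite count_map -size_filter.
  rewrite -(card_uniqP (filter_uniq _ U)); apply: eq_card => z.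
  by rewrite inE ME mem_filter /= eq_porbit_mem andbC.
have -> : distribution (tperm2M s a b c d) =
    [seq count_mem B (map (porbit s) l)
       | B <- enum (porbits s) & M :&: B != set0].
  by apply/eq_in_map => B; rewrite mem_filter mem_enum => /andP[_ /cardM].
apply: perm_map; apply: uniq_perm => [||B].
- exact/filter_uniq/enum_uniq.
- exact: undup_uniq.
 rewrite mem_filter mem_undup mem_enum.
apply/andP/mapP=> [[/set0Pn[z]]|[z zl ->]].
  rewrite inE ME => /andP[zl zB] /imsetP[x _ eB]; exists z => //.
  by apply/esym/eqP; rewrite eB eq_porbit_mem -eB.
split; last exact: imset_f.
by apply/set0Pn; exists z; rewrite inE ME zl porbit_id.
Qed.

(** With products composed left to right, [s ^ alpha^-1] sends [z] to [alpha^-1 (s (alpha z))];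
    applying [alpha] compares it with [s z]. *)
Lemma bad_pointsJ (alpha : 'S_n) :
  bad_points alpha s = moved_by s (s ^ alpha^-1)%g.
Proof.
apply/setP=> z; rewrite !inE conjgE invgK !permM.
by rewrite (canF_eq (permK alpha)) eq_sym.
Qed.

Lemma bad_distributionJ (alpha : 'S_n) :
  bad_distribution alpha s = distribution (s ^ alpha^-1)%g.
Proof. by rewrite /bad_distribution bad_pointsJ. Qed.

(** The common reduction for all counts: [P] is a condition on the conjugate, [Q] its translation to
    tuples. *)
Lemma card_centralizer_sum4 (P : pred 'S_n)
    (Q : 'I_n -> 'I_n -> 'I_n -> 'I_n -> bool) :
  (forall a b c d, uniq [:: a; b; c; d] -> P (tperm2M s a b c d) = Q a b c d) ->
  8 * #|[set alpha : 'S_n | k_commutes 4 alpha s && P (s ^ alpha^-1)%g]| =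
  #|'C[s]%g| * sum4 (fun a b c d => [&& uniq [:: a; b; c; d],
      tperm2M s a b c d \in (s ^: [set: 'S_n])%g & Q a b c d]).
Proof.
move=> PQ; pose R t := (#|moved_by s t| == 4) && P t.
have -> : #|[set alpha : 'S_n | k_commutes 4 alpha s && P (s ^ alpha^-1)%g]| =
          #|[set alpha : 'S_n | R (s ^ alpha)%g]|.
  rewrite -!sum1dep_card [RHS](reindex_inj invg_inj) /=.
  by apply: eq_bigl => alpha; rewrite /R /k_commutes bad_pointsJ.
rewrite card_conj_fiber mulnCA (card_conj_moved4 s P); congr (_ * _).
apply: eq_sum4 => a b c d; congr nat_of_bool.
by case: (boolP (uniq _)) => // /PQ ->.
Qed.

Lemma num_part_commutingE ks : sumn ks = 4 ->
  8 * num_part_commuting ks s = #|'C[s]%g| *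
   sum4 (fun a b c d => [&& uniq [:: a; b; c; d],
      tperm2M s a b c d \in (s ^: [set: 'S_n])%g
    & perm_eq (tally_counts (map (porbit s) [:: a; b; c; d])) ks]).
Proof.
move=> ks4; rewrite /num_part_commuting ks4.
rewrite -(@card_centralizer_sum4 (fun t => perm_eq (distribution t) ks)).
  congr (8 * _); apply: eq_card => alpha; rewrite !inE bad_distributionJ //.
by move=> a b c d /distribution_tperm2M /permPl ->.
Qed.

Lemma num_k_commutingE : 8 * num_k_commuting 4 s = #|'C[s]%g| *
   sum4 (fun a b c d => [&& uniq [:: a; b; c; d] &
      tperm2M s a b c d \in (s ^: [set: 'S_n])%g]).
Proof.
transitivity (#|'C[s]%g| * sum4 (fun a b c d => [&& uniq [:: a; b; c; d],
      tperm2M s a b c d \in (s ^: [set: 'S_n])%g & true])).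
  rewrite -(@card_centralizer_sum4 xpredT) //; congr (8 * _).
  by apply: eq_card => alpha; rewrite !inE andbT.
by congr (_ * _); apply: eq_sum4 => a b c d; rewrite andbT.
Qed.

End Distribution.

(** * Admissible tuples for each distribution *)

Section Patterns.
Variables (T : finType) (s : {perm T}).
Implicit Types (a b c d x y z : T).
Local Notation O := (porbit s).
(* If c and d share a cycle, [piece c d c] and [piece c d d] are the two parts it
   is split into; otherwise both are the merged cycle. *)
Local Notation piece c d := (porbit (tperm c d * s)%g).
Local Notation cj a b c d := (tperm2M s a b c d \in (s ^: [set: {perm T}])%g).

Lemma porbit_merge c d : d \notin O c -> piece c d c = O c :|: O d.
Proof.
move=> dNc; have ne_cd : c != d by apply: contraNneq dNc => ->; apply: porbit_id.
rewrite (@porbit_split _ _ c d) //; last by rewrite mem_porbit_mul_tperm.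
by rewrite !tpermKg.
Qed.

Lemma piece_disjoint c d x : c != d -> d \in O c ->
  x \in piece c d c -> x \notin piece c d d.
Proof.
move=> ne_cd dc; rewrite -!eq_porbit_mem => /eqP->; rewrite eq_porbit_mem.
by rewrite porbit_sym mem_porbit_mul_tperm // dc.
Qed.

Lemma piece_cover c d x : c != d -> d \in O c -> x \in O c ->
  (x \in piece c d d) = (x \notin piece c d c).
Proof.
move=> ne_cd dc xc; case: (boolP (x \in piece c d c)) => [xp|xNp] /=.
  by apply/negbTE/piece_disjoint.
by move: xc; rewrite (porbit_split ne_cd dc) inE (negbTE xNp).
Qed.

Lemma piece_sub c d x y : y \in [:: c; d] -> c != d -> d \in O c ->
  x \in piece c d y -> x \in O c.
Proof.
move=> yl ne_cd dc xy; rewrite (porbit_split ne_cd dc) inE.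
by move: yl xy; rewrite !inE => /orP[] /eqP-> ->; rewrite ?orbT.
Qed.

Lemma piece_out c d x : d \in O c -> x \notin O c -> piece c d x = O x.
Proof.
move=> dc xNc; rewrite porbit_mul_tpermD //.
by move: dc; rewrite -eq_porbit_mem => /eqP->.
Qed.

(** Splitting the cycle of [c] and [d] leaves [a] and [b] together in theirs, so the second
    transposition splits as well. *)
Lemma conj_disjoint_pairs a b c d : uniq [:: a; b; c; d] ->
  O a = O b -> O c = O d -> O a <> O c -> cj a b c d = false.
Proof.
rewrite /= !inE !negb_or => /and4P[/and3P[ab ac ad] /andP[bc bd] cd _] eab ecd nac.
have dc : d \in O c by rewrite -eq_porbit_mem ecd.
have aNc : a \notin O c by rewrite -eq_porbit_mem; apply/eqP.
have ba : b \in O a by rewrite -eq_porbit_mem eab.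
by rewrite conj_split_merge // (piece_out dc aNc) ba.
Qed.

(** Joining [c] to [d] is a merge, so [a] and [b] must become members of one cycle; being apart
    before, they lie one in each of the two merged cycles. *)
Lemma conj_two_merges a b c d : uniq [:: a; b; c; d] -> cj a b c d ->
  O a <> O b -> O c <> O d -> (O a = O c /\ O b = O d) \/ (O a = O d /\ O b = O c).
Proof.
rewrite /= !inE !negb_or => /and4P[/and3P[ab ac ad] /andP[bc bd] cd _] + nab ncd.
have dNc : d \notin O c by rewrite -eq_porbit_mem; apply/eqP/nesym.
rewrite conj_merge_split // => /andP[bau _].
have [aM|aNM] := boolP (a \in O c :|: O d).
  have : b \in O c :|: O d.
    move: bau aM; rewrite -(porbit_merge dNc) -!eq_porbit_mem.
    by move=> /eqP-> /eqP->.
  move: aM nab; rewrite !inE -!eq_porbit_mem.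
  by case/orP=> /eqP-> nab /orP[] /eqP eb; rewrite eb in nab *; auto.
move: aNM; rewrite inE negb_or => /andP[aNc aNd].
by case: nab; apply/esym/eqP; rewrite eq_porbit_mem -(porbit_mul_tpermD aNc aNd).
Qed.

(** Once [a] and [b] lie in different pieces, joining these restores a cycle of the original length,
    so no length condition remains. Removing [c] and [d] from their pieces keeps the four points
    distinct. *)
Lemma one_orbit_conj a b c d :
  [&& uniq [:: a; b; c; d], cj a b c d & [&& O a == O b, O b == O c & O c == O d]]
  = [&& c != d, d \in O c &
      (a \in piece c d c :\ c) && (b \in piece c d d :\ d)
      || (a \in piece c d d :\ d) && (b \in piece c d c :\ c)].
Proof.
have -> : [&& O a == O b, O b == O c & O c == O d]
          = [&& d \in O c, a \in O c & b \in O c].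
  rewrite -!eq_porbit_mem; have [->|] := eqVneq (O b) (O c); last by rewrite !andbF.
  by rewrite andbT andTb andbC eq_sym.
have [<-|ne_cd] /= := eqVneq c d; first by rewrite !inE eqxx /= !andbF.
have [dc|] /= := boolP (d \in O c); last by rewrite !andbF.
have [ac|aNc] := boolP (a \in O c); last first.
  have nin y : y \in [:: c; d] -> a \in piece c d y = false.
    by move=> yl; apply: contraNF aNc; apply: piece_sub.
  by rewrite !inE !nin ?inE ?eqxx ?orbT // !andbF.
have [bc|bNc] := boolP (b \in O c); last first.
  have nin y : y \in [:: c; d] -> b \in piece c d y = false.
    by move=> yl; apply: contraNF bNc; apply: piece_sub.
  by rewrite !inE !nin ?inE ?eqxx ?orbT // !andbF.
rewrite !andbT !inE !(piece_cover ne_cd dc) // !negb_or /=.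
have [<-|ne_ab] /= := eqVneq a b; first by case: (a \in _); rewrite ?andbF.
rewrite conj_split_merge //.
have cP : c \in piece c d c := porbit_id _ _.
have dP : d \notin piece c d c.
  by rewrite -(piece_cover ne_cd dc) // porbit_id.
have ne (x y : T) : (x \in piece c d c) != (y \in piece c d c) -> x != y.
  by apply: contraNneq => ->.
have pE x : x \in O c ->
    piece c d x = if x \in piece c d c then piece c d c else piece c d d.
  move=> xc; case: ifPn => [|xN]; first by rewrite -eq_porbit_mem => /eqP.
  by apply/eqP; rewrite eq_porbit_mem piece_cover.
rewrite (pE a) // (pE b) //.
have [aP|aN] := boolP (a \in piece c d c); have [bP|bN] := boolP (b \in piece c d c);
  rewrite ?bP ?(negbTE bN) ?piece_cover ?bP ?bN //= ?andbF ?andbT ?orbF //.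
- have ad : a != d by apply: ne; rewrite aP (negbTE dP).
  have b_c : b != c by apply: ne; rewrite cP (negbTE bN).
  by rewrite perm_refl ad b_c ne_cd !andbT.
have a_c : a != c by apply: ne; rewrite cP (negbTE aN).
have b_d : b != d by apply: ne; rewrite bP (negbTE dP).
rewrite a_c b_d ne_cd /= !andbT (perm_catC [:: #|piece c d c|] [:: #|piece c d d|]).
by rewrite perm_refl andbT.
Qed.

(** The piece containing [a] is merged with the cycle of [b], so the lengths are restored exactly
    when that cycle is as long as the other piece. The two terms correspond to the two pieces in
    which [a] may lie. *)
Lemma three_one_conj a b c d :
  ([&& uniq [:: a; b; c; d], cj a b c d & [&& O a == O c, O c == O d & O a != O b]]
    : nat)
  = [&& c != d, d \in O c, a \in piece c d c :\ c & #|O b| == #|piece c d d|]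
  + [&& d != c, c \in O d, a \in piece d c d :\ d & #|O b| == #|piece d c c|].
Proof.
rewrite (tpermC d c) (porbit_sym s c d) (eq_sym d).
have -> : [&& O a == O c, O c == O d & O a != O b]
          = [&& d \in O c, a \in O c & b \notin O c].
  rewrite -!eq_porbit_mem (eq_sym (O d)) (eq_sym (O b)).
  by have [->|] := eqVneq (O a) (O c); rewrite /= ?andbF.
have [<-|ne_cd] /= := eqVneq c d; first by rewrite !inE eqxx /= !andbF.
have [dc|] /= := boolP (d \in O c); last by rewrite !andbF.
have card_c := card_porbit_mul_tperm ne_cd dc.
have piece_gt0 y : 0 < #|piece c d y| by rewrite lt0n card_porbit_neq0.
have [ac|aNc] := boolP (a \in O c); last first.
  have nin y : y \in [:: c; d] -> a \in piece c d y = false.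
    by move=> yl; apply: contraNF aNc; apply: piece_sub.
  by rewrite !inE !nin ?inE ?eqxx ?orbT // !andbF.
(* The right-hand side excludes this case through lengths: a piece is strictly shorter than the
   whole cycle. *)
have [bc|bNc] /= := boolP (b \in O c).
  have -> : #|O b| = #|O c| by move: bc; rewrite -eq_porbit_mem => /eqP->.
  rewrite -card_c andbF; have := piece_gt0 c; have := piece_gt0 d.
  move: #|piece c d c| #|piece c d d| => p q p0 q0.
  have -> : (p + q == p) = false by lia.
  have -> : (p + q == q) = false by lia.
  by rewrite !andbF.
rewrite andbT !inE (piece_cover ne_cd dc) //.
have b_a : a != b by apply: contraNneq bNc => <-.
have b_c : b != c by apply: contraNneq bNc => ->; rewrite porbit_id.
have b_d : b != d by apply: contraNneq bNc => ->.
rewrite !negb_or b_a b_c b_d ne_cd !andbT /= conj_split_merge // (piece_out dc bNc).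
have cP : c \in piece c d c := porbit_id _ _.
have dP : d \notin piece c d c.
  by rewrite -(piece_cover ne_cd dc) // porbit_id.
have eac : O a = O c by apply/eqP; rewrite eq_porbit_mem.
have -> : b \notin piece c d a.
  by rewrite porbit_sym (piece_out dc bNc) porbit_sym eac.
rewrite perm_eq2 /=.
have [aP|aN] := boolP (a \in piece c d c).
  have eqa : piece c d a = piece c d c by apply/eqP; rewrite eq_porbit_mem.
  have a_d : a != d by apply: contraNneq dP => eqad; rewrite -{1}eqad.
  rewrite eqa eqxx a_d /= !andbT addn0; congr (nat_of_bool (_ && _)).
  by move: #|O b| #|piece c d c| #|piece c d d|; clear; lia.
have eqa : piece c d a = piece c d d by apply/eqP; rewrite eq_porbit_mem piece_cover.
have a_c : a != c by apply: contraNneq aN => ->.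
rewrite eqa eqxx a_c /= add0n !andbT; congr (nat_of_bool (_ && _)).
by move: #|O b| #|piece c d c| #|piece c d d|; clear; lia.
Qed.

(** The two pieces of the cycle of [c] replace the merged cycles of [a] and [b]. Such lengths
    already keep [a] and [b] out of the cycle of [c], which is longer than its pieces. *)
Lemma two_one_one_conj a b c d :
  [&& uniq [:: a; b; c; d], cj a b c d
    & [&& O c == O d, O a != O c, O b != O c & O a != O b]]
  = [&& c != d, d \in O c, O a != O b &
      perm_eq [:: #|piece c d c|; #|piece c d d|] [:: #|O a|; #|O b|]].
Proof.
have -> : (O c == O d) = (d \in O c) by rewrite eq_sym eq_porbit_mem.
have [<-|ne_cd] /= := eqVneq c d; first by rewrite !inE eqxx /= !andbF.
have [dc|] /= := boolP (d \in O c); last by rewrite !andbF.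
have card_c := card_porbit_mul_tperm ne_cd dc.
have [|ab] /= := eqVneq (O a) (O b); first by rewrite !andbF.
have noc x (y : nat) : O x = O c ->
    perm_eq [:: #|piece c d c|; #|piece c d d|] [:: #|O x|; y] -> False.
  move=> eqx /perm_mem/(_ #|O x|).
  rewrite !inE eqxx /= eqx -card_c.
  have : 0 < #|piece c d c| by rewrite lt0n card_porbit_neq0.
  have : 0 < #|piece c d d| by rewrite lt0n card_porbit_neq0.
  by move: #|piece c d c| #|piece c d d|; clear; lia.
have [ac|aNc] /= := eqVneq (O a) (O c).
  by rewrite !andbF; apply/esym/negP=> /(noc _ _ ac).
have [bc|bNc] /= := eqVneq (O b) (O c).
  rewrite !andbF; apply/esym/negP.
  by rewrite perm_sym (perm_catC [:: #|O a|] [:: #|O b|]) perm_sym => /(noc _ _ bc).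
have Oc : O c = O d by apply/eqP; rewrite eq_sym eq_porbit_mem.
have ne (x y : T) : O x != O y -> x != y by apply: contraNneq => ->.
rewrite andbT !inE !negb_or (ne a b) // (ne a c) // (ne b c) //.
rewrite (ne a d) -?Oc // (ne b d) -?Oc // ne_cd /=.
rewrite conj_split_merge ?(ne a b) //.
have aN : a \notin O c by rewrite -eq_porbit_mem.
have bN : b \notin O c by rewrite -eq_porbit_mem.
by rewrite (piece_out dc aN) (piece_out dc bN) -eq_porbit_mem eq_sym ab andbT.
Qed.

(** From [d], the merged cycle runs through the old cycle of [c] and reaches [c] last. This is the
    splitting computation with [s] seen as a split of [u]. *)
Lemma exp_porbit_merge c d q : d \notin O c -> 0 < q <= #|O c| ->
  (s ^+ q)%g c = ((tperm c d * s) ^+ q)%g d.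
Proof.
set u := (_ * _)%g => dNc.
have ne_dc : d != c by apply: contraNneq dNc => ->; apply: porbit_id.
have defs : s = (tperm d c * u)%g by rewrite tpermC tpermKg.
have : c \in porbit u d.
  by rewrite porbit_sym mem_porbit_mul_tperm // eq_sym.
case/porbit_expP=> k ltk def_c.
have k_gt0 : 0 < k.
  by rewrite lt0n; apply: contraNneq ne_dc => k0; rewrite def_c k0 expg0 perm1.
have card_c : #|O c| = k.
  have := @card_porbit_split _ u d k; rewrite -def_c -defs; apply.
  by rewrite k_gt0.
rewrite card_c => qk; rewrite -(exp_mul_tperm ltk qk) -def_c.
by rewrite {1}defs.
Qed.

(** The merged cycle is cut into lengths [#|O c| + p - q] and [#|O d| + q - p]; the alternatives say
    that these are the old lengths in the same or in the opposite order. *)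
Lemma two_two_conj c d q p : d \notin O c -> 0 < q < #|O c| -> 0 < p < #|O d| ->
  cj ((s ^+ q)%g c) ((s ^+ p)%g d) c d = (p == q) || (#|O c| + p == #|O d| + q).
Proof.
move=> dNc qI pI; set u := (tperm c d * s)%g.
have [q0 ltq] := andP qI; have [p0 ltp] := andP pI.
have ne_cd : c != d by apply: contraNneq dNc => ->; apply: porbit_id.
have dc : d \in porbit u c by rewrite mem_porbit_mul_tperm.
have card_u : #|porbit u d| = #|O c| + #|O d|.
  have := card_porbit_mul_tperm ne_cd dc; rewrite tpermKg => ->.
  by move: dc; rewrite -eq_porbit_mem => /eqP->.
set a := (s ^+ q)%g c; set b := (s ^+ p)%g d.
(* In the merged cycle, counting from d: a is at q, c at |O c|, b at |O c| + p. *)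
have aE : a = (u ^+ q)%g d by rewrite /a (@exp_porbit_merge c d) // q0 ltnW.
have cE : c = (u ^+ #|O c|)%g d.
  rewrite -(@exp_porbit_merge c d) ?exp_porbit // leqnn andbT.
  exact: leq_trans q0 (ltnW ltq).
have bE : b = (u ^+ (#|O c| + p - q))%g a.
  have -> : b = (u ^+ p)%g c.
    rewrite /b (@exp_porbit_merge d c) ?(tpermC d) //; last by rewrite p0 ltnW.
    by rewrite porbit_sym.
  rewrite [in LHS]cE aE -!permM -!expgD; congr ((u ^+ _)%g _).
  by rewrite subnKC // (leq_trans (ltnW ltq)) ?leq_addr.
have card_a : #|porbit u a| = #|O c| + #|O d| by rewrite aE porbit_perm.
have kI : 0 < #|O c| + p - q < #|porbit u a| by rewrite card_a; lia.
rewrite conj_merge_split //; last first.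
  apply/eqP=> eab; suff : #|O c| + p - q = 0 by lia.
  by apply: (@porbit_exp_inj _ u a); rewrite ?expg0 ?perm1 -?bE //; lia.
have -> : b \in porbit u a by rewrite bE mem_porbit.
rewrite /= /tperm2M -/u bE card_porbit_split // card_porbit_splitl // card_a.
rewrite perm_eq2; move: q0 p0 ltp ltq; move: #|O c| #|O d|; clear; lia.
Qed.

End Patterns.

(** * Counting the admissible tuples *)

Section PatternSplit.
Variables (X : eqType) (A B C D : X) (e : bool).
Let t := tally_counts [:: A; B; C; D].

(* [e] will say that the tuple is repetition-free and keeps the cycle type; the
   hypotheses exclude two splits and two merges. *)
Hypothesis no_disjoint_pairs : e -> A = B -> C = D -> A <> C -> False.
Hypothesis no_two_merges : e -> A <> B -> C <> D ->
  (A = C /\ B = D) \/ (A = D /\ B = C).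

(** For [3,1] the four terms say which entry is alone. For [2,2] the pairing of [A] with [B] is
    excluded, and for [2,1,1] the equal entries must be [C], [D] or [A], [B]. *)
Lemma pattern_split :
  [/\ (e : nat) = (e && perm_eq t [:: 4]) + (e && perm_eq t [:: 3; 1])
              + (e && perm_eq t [:: 2; 2]) + (e && perm_eq t [:: 2; 1; 1]),
      (e && perm_eq t [:: 3; 1] : nat) =
        (e && [&& A == C, C == D & A != B]) + (e && [&& B == C, C == D & B != A])
        + (e && [&& C == A, A == B & C != D]) + (e && [&& D == A, A == B & D != C]),
      (e && perm_eq t [:: 2; 2] : nat) =
        (e && [&& A == C, B == D & A != B]) + (e && [&& B == C, A == D & B != A])
    & (e && perm_eq t [:: 2; 1; 1] : nat) =
        (e && [&& C == D, A != C, B != C & A != B])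
        + (e && [&& A == B, C != A, D != A & C != D])].
Proof.
have [-> -> -> ->] := tally_counts4 A B C D.
move: no_disjoint_pairs no_two_merges; case: e => // H1 H2.
move: (H1 isT) (H2 isT) => {}H1 {}H2.
rewrite ?(eq_sym B A) ?(eq_sym C A) ?(eq_sym D A)
  ?(eq_sym C B) ?(eq_sym D B) ?(eq_sym D C).
case EAB: (A == B); case EAC: (A == C); case EAD: (A == D);
case EBC: (B == C); case EBD: (B == D); case ECD: (C == D) => //;
exfalso; move/eqP: EAB; move/eqP: EAC; move/eqP: EAD;
move/eqP: EBC; move/eqP: EBD; move/eqP: ECD; intuition congruence.
Qed.
End PatternSplit.

(** * Elementary identities for finite sums *)

Lemma sum_nat_diag (m : nat) (F : nat -> nat -> nat) :
  \sum_(1 <= i < m.+1) \sum_(1 <= j < m.+1) F i j =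
  \sum_(1 <= i < m.+1) F i i
  + \sum_(1 <= i < m.+1) \sum_(i + 1 <= j < m.+1) (F i j + F j i).
Proof.
elim: m => [|m IHm]; first by rewrite !big_geq.
rewrite [in LHS]big_nat_recr //=.
under eq_big_nat do rewrite big_nat_recr //=.
rewrite big_split /= IHm [\sum_(1 <= j < m.+2) F _ j]big_nat_recr //=.
rewrite [\sum_(1 <= i < m.+2) F i i]big_nat_recr //=.
rewrite [\sum_(1 <= i < m.+2) \sum_(_ <= _ < _) _]big_nat_recr //=.
rewrite [\sum_(m.+1 + 1 <= _ < _) _]big_geq ?addn1 // addn0.
have -> : \sum_(1 <= i < m.+1) \sum_(i + 1 <= j < m.+2) (F i j + F j i) =
  \sum_(1 <= i < m.+1) \sum_(i + 1 <= j < m.+1) (F i j + F j i)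
  + (\sum_(1 <= i < m.+1) F i m.+1 + \sum_(1 <= i < m.+1) F m.+1 i).
  rewrite -!big_split; apply: eq_big_nat => i /andP[_ lti].
  by rewrite big_nat_recr //= addn1.
lia.
Qed.

(** Three-element subsets of the integers from 1 to [m - 1], sorted by their middle element [k]. *)
Lemma sum_cut_bin m : \sum_(1 <= k < m) (m - k - 1) * (k - 1) = 'C(m.-1, 3).
Proof.
case: m => [|m]; first by rewrite big_geq.
rewrite big_add1 /= big_mkord.
transitivity (\sum_(j < m) (m - 1 - j) * j).
  by apply: eq_bigr => j _; congr (_ * _); lia.
elim: m => [|m IHm]; first by rewrite big_ord0.
rewrite big_ord_recr /= subn1 subnn mul0n addn0 binS -IHm -bin2_sum.
rewrite big_mkord -big_split /=; apply: eq_bigr => j _.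
have := ltn_ord j; nia.
Qed.

(** * Sums over points expressed through cycle lengths *)

Section OrbitSums.
Variables (T : finType) (s : {perm T}).
Implicit Types (a b c d x y z : T).
Local Notation O := (porbit s).
Local Notation piece c d := (porbit (tperm c d * s)%g).

Definition cycles_of_length i := #|[set B in porbits s | #|B| == i]|.
Local Notation N := cycles_of_length.

Lemma big_porbitD1 (F : T -> nat) c :
  \sum_(a in O c :\ c) F a = \sum_(1 <= q < #|O c|) F ((s ^+ q)%g c).
Proof.
set r := [seq (s ^+ q)%g c | q <- index_iota 1 #|O c|].
have Ur : uniq r.
  rewrite map_inj_in_uniq ?iota_uniq // => q p; rewrite !mem_index_iota.
  by move=> /andP[_ ltq] /andP[_ ltp]; apply: porbit_exp_inj.
rewrite -(big_map (fun q => (s ^+ q)%g c) xpredT F) -/r big_uniq //=.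
apply: eq_bigl => a; apply/idP/mapP=> [|[q]]; last first.
  rewrite mem_index_iota => /andP[q_gt0 ltq] ->; rewrite !inE mem_porbit andbT.
  apply/eqP=> eqc; suff: q = 0 by lia.
  apply: (@porbit_exp_inj _ s c) => //; first by lia.
  by rewrite expg0 perm1.
rewrite !inE => /andP[ne_ac /porbit_expP[q ltq def_a]]; exists q => //.
rewrite mem_index_iota ltq andbT lt0n; apply: contraNneq ne_ac => q0.
by rewrite def_a q0 expg0 perm1.
Qed.

Lemma sum_cycle_lengths (F : nat -> nat) :
  \sum_x F #|O x| = \sum_(1 <= i < #|T|.+1) i * N i * F i.
Proof.
transitivity (\sum_(B in porbits s) #|B| * F #|B|).
  rewrite (partition_big_imset O) /=; apply: eq_bigr => _ /imsetP[x _ ->].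
  rewrite -sum_nat_const; apply: eq_big => [y|y /eqP->] //.
  by rewrite eq_porbit_mem.
have -> : \sum_(1 <= i < #|T|.+1) i * N i * F i
        = \sum_(i < #|T|.+1) i * N i * F i.
  by rewrite -(big_mkord xpredT (fun i => i * N i * F i)) [RHS]big_ltn.
(* No cycle is longer than [#|T|], so [inord] does not alter its length. *)
rewrite (partition_big (fun B : {set T} => inord #|B| : 'I_#|T|.+1) xpredT) //=.
apply: eq_bigr => i _; rewrite -mulnA mulnCA -sum_nat_const.
have inordE (B : {set T}) : (inord #|B| == i :> 'I_#|T|.+1) = (#|B| == i).
  by rewrite -val_eqE /= inordK // ltnS max_card.
apply: eq_big => [B|B /andP[_]]; first by rewrite !inE inordE.
by rewrite inordE => /eqP->.
Qed.

Lemma card_length_class k : \sum_x (#|O x| == k : nat) = k * N k.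
Proof.
rewrite (sum_cycle_lengths (fun i => i == k)).
have [/andP[k_gt0 lek]|kI] := boolP (1 <= k < #|T|.+1).
  rewrite (bigD1_seq k) ?mem_index_iota ?k_gt0 ?iota_uniq //= eqxx muln1.
  by rewrite big1 ?addn0 // => i /negbTE->; rewrite muln0.
rewrite big_nat big1 => [|i iI]; last first.
  by case: eqP => [eik|]; rewrite ?muln0 //; move: kI; rewrite -eik iI.
have [->|k0] := eqVneq k 0; first by rewrite mul0n.
rewrite /N (_ : [set B in _ | _] = set0) ?cards0 ?muln0 //.
apply/setP=> B; rewrite !inE; apply/negbTE/negP=> /andP[_ /eqP eqk].
by move: kI; rewrite -eqk ltnS max_card andbT lt0n eqk k0.
Qed.

Lemma sum_cut (F : nat -> nat -> nat) c :
  \sum_(d in O c :\ c) F #|piece c d c| #|piece c d d| =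
  \sum_(1 <= k < #|O c|) F (#|O c| - k) k.
Proof.
rewrite big_porbitD1; apply: eq_big_nat => k kI.
by rewrite card_porbit_split // card_porbit_splitl.
Qed.

(** Cycles of equal length form [N i * (N i - 1)] ordered pairs, which is twice the binomial; for
    unequal lengths the symmetry of [G] gives the factor 2. *)
Lemma sum_distinct_cycles (G : nat -> nat -> nat) :
  (forall i j, G i j = G j i) ->
  \sum_a \sum_b (O a != O b) * G #|O a| #|O b| =
  \sum_(1 <= i < #|T|.+1) i ^ 2 * (2 * 'C(N i, 2)) * G i i
  + 2 * \sum_(1 <= i < #|T|.+1) \sum_(i + 1 <= j < #|T|.+1)
      i * j * N i * N j * G i j.
Proof.
move=> Gsym; set lhs := LHS; set rhs := RHS.
(* [S] is the contribution of pairs in a common cycle; adding it to both sides avoids subtraction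
   and makes the left side a full double sum. *)
pose S := \sum_(1 <= i < #|T|.+1) i ^ 2 * N i * G i i.
suff: lhs + S = rhs + S by move/addIn.
transitivity (\sum_(1 <= i < #|T|.+1) \sum_(1 <= j < #|T|.+1)
    (i * N i) * (j * N j) * G i j).
  have -> : S = \sum_a \sum_b (O a == O b) * G #|O a| #|O b|.
    transitivity (\sum_a #|O a| * G #|O a| #|O a|).
      rewrite (sum_cycle_lengths (fun i => i * G i i)); apply: eq_bigr => i _.
      by rewrite mulnACA mulnn mulnA.
    apply: eq_bigr => a _; rewrite -sum_nat_const big_mkcond; apply: eq_bigr => b _.
    rewrite (eq_sym (O a)) eq_porbit_mem.
    have [|_] := boolP (b \in O a); last by rewrite mul0n.
    by rewrite -eq_porbit_mem => /eqP->; rewrite mul1n.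
  rewrite -big_split /=.
  transitivity (\sum_a \sum_b G #|O a| #|O b|).
    apply: eq_bigr => a _; rewrite -big_split; apply: eq_bigr => b _ /=.
    by case: eqP; rewrite ?mul0n ?mul1n ?addn0.
  rewrite (sum_cycle_lengths (fun i => \sum_b G i #|O b|)); apply: eq_bigr => i _.
  rewrite sum_cycle_lengths big_distrr /=; apply: eq_bigr => j _.
  by rewrite mulnA.
rewrite sum_nat_diag /rhs [RHS]addnAC -[X in _ = X + _]big_split /=; congr (_ + _).
  apply: eq_bigr => i _; have := mul_bin_diag (N i) 1; rewrite bin1.
  case: (N i) => [|m] /=; first by rewrite !(muln0, mul0n).
  by move=> <-; nia.
rewrite big_distrr; apply: eq_bigr => i _; rewrite big_distrr /=.
by apply: eq_bigr => j _; rewrite (Gsym j i); nia.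
Qed.

End OrbitSums.

(** * Number of admissible tuples in each normal form *)

Section PatternSums.
Variables (T : finType) (s : {perm T}).
Implicit Types (a b c d x y z : T).
Local Notation O := (porbit s).
Local Notation piece c d := (porbit (tperm c d * s)%g).
Local Notation cj a b c d := (tperm2M s a b c d \in (s ^: [set: {perm T}])%g).
Local Notation N := (cycles_of_length s).

Lemma sum4_swap (F : T -> T -> T -> T -> nat) :
  sum4 (fun a b c d => F b a c d) = sum4 F.
Proof. exact: exchange_big. Qed.

Lemma sum4_swap_pairs (F : T -> T -> T -> T -> nat) :
  sum4 (fun a b c d => F c d a b) = sum4 F.
Proof.
rewrite /sum4; under eq_bigr do rewrite exchange_big.
rewrite exchange_big; apply: eq_bigr => c _.
under eq_bigr do rewrite exchange_big.
by rewrite exchange_big; apply: eq_bigr => d _.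
Qed.

Lemma eq_sum4_pairs (F : T -> T -> T -> T -> nat) (G : T -> T -> nat) :
  (forall c d, \sum_a \sum_b F a b c d = G c d) ->
  sum4 F = \sum_c \sum_d G c d.
Proof.
move=> FG; rewrite -sum4_swap_pairs.
by apply: eq_bigr => c _; apply: eq_bigr => d _.
Qed.

Lemma sum_mem2 (A B : {set T}) :
  \sum_a \sum_b ((a \in A) && (b \in B) : nat) = #|A| * #|B|.
Proof.
rewrite -sum_nat_const [RHS]big_mkcond; apply: eq_bigr => a _.
case: (a \in A); last by rewrite big1.
by rewrite -sum1_card [RHS]big_mkcond; apply: eq_bigr => b _; case: (b \in B).
Qed.

Lemma cardsD1_mem (A : {set T}) x : x \in A -> #|A :\ x| = #|A|.-1.
Proof. by move=> xA; rewrite (cardsD1 x A) xA. Qed.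

Lemma sum_other_in_cycle (F : T -> nat) c :
  \sum_d (c != d) && (d \in O c) * F d = \sum_(d in O c :\ c) F d.
Proof.
rewrite [RHS]big_mkcond; apply: eq_bigr => d _.
by rewrite !inE (eq_sym d); case: (_ && _); rewrite ?mul1n ?mul0n.
Qed.

(** Four points of a cycle have a single pairing in which each pair separates the other, and it is
    listed by eight tuples. In the computation, 8 is 2 times the 4 of
    [i * 'C(i.-1, 3) = 4 * 'C(i, 4)]. *)
Lemma sum4_one_orbit :
  sum4 (fun a b c d => [&& uniq [:: a; b; c; d], cj a b c d
                         & [&& O a == O b, O b == O c & O c == O d]])
  = 8 * \sum_(4 <= i < #|T|.+1) N i * 'C(i, 4).
Proof.
transitivity (\sum_c \sum_(d in O c :\ c)
    2 * ((#|piece c d c| - 1) * (#|piece c d d| - 1))).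
  under [RHS]eq_bigr do rewrite -sum_other_in_cycle.
  apply: eq_sum4_pairs => c d.
  under eq_bigr do under eq_bigr do rewrite one_orbit_conj.
  have [<-|ne_cd] /= := eqVneq c d; first by rewrite !big1 // => a _; rewrite big1.
  have [dc|_] /= := boolP (d \in O c); last by rewrite !big1 // => a _; rewrite big1.
  transitivity (\sum_a \sum_b (((a \in piece c d c :\ c) && (b \in piece c d d :\ d))
      + ((a \in piece c d d :\ d) && (b \in piece c d c :\ c)))).
    apply: eq_bigr => a _; apply: eq_bigr => b _.
    have := @piece_disjoint _ s c d a ne_cd dc; rewrite !inE.
    case: (a \in piece c d c) => [/(_ isT)/negbTE->|_]; last by rewrite andbF.
    by rewrite !andbF orbF addn0.
  under eq_bigr do rewrite big_split.
  rewrite big_split /= !sum_mem2 !cardsD1_mem ?porbit_id // !subn1 mul1n.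
  by rewrite mul2n -addnn [X in _ + X]mulnC.
transitivity (\sum_c 2 * 'C(#|O c|.-1, 3)).
  apply: eq_bigr => c _.
  rewrite (sum_cut s (fun p q => 2 * ((p - 1) * (q - 1)))) -big_distrr /=.
  by rewrite sum_cut_bin.
rewrite (sum_cycle_lengths s (fun i => 2 * 'C(i.-1, 3))).
transitivity (\sum_(1 <= i < #|T|.+1) 8 * (N i * 'C(i, 4))).
  apply: eq_bigr => i _.
  rewrite (mulnC i) -mulnA (mulnCA i) mul_bin_diag.
  by move: (N i) 'C(_, 4); clear; lia.
rewrite -big_distrr /=; congr (8 * _).
have [le4|lt4] := leqP 4 #|T|.+1.
  rewrite (@big_cat_nat _ _ _ 4) //= [X in X + _]big_nat big1 // => i /andP[_ lti].
  by rewrite bin_small ?muln0.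
rewrite [RHS]big_geq ?(ltnW lt4) // big_nat big1 // => i /andP[_ lti].
by rewrite bin_small ?muln0 // (ltn_trans lti lt4).
Qed.

(** In a cycle of length j, a cut leaving i points on the far side gives j - i - 1 choices of [a],
    and [i * N i] choices of [b] fit. The factor 2 is the exchange of [c] and [d]. *)
Lemma sum4_three_one :
  sum4 (fun a b c d => [&& uniq [:: a; b; c; d], cj a b c d
                         & [&& O a == O c, O c == O d & O a != O b]])
  = 2 * \sum_(1 <= i < #|T|.+1) \sum_(i + 2 <= j < #|T|.+1)
          i * j * (j - i - 1) * N i * N j.
Proof.
pose X a b c d : nat :=
  [&& c != d, d \in O c, a \in piece c d c :\ c & #|O b| == #|piece c d d|].
transitivity (sum4 (fun a b c d => X a b c d + X a b d c)).
  by apply: eq_sum4 => a b c d; apply: three_one_conj.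
rewrite sum4D; have -> : sum4 (fun a b c d => X a b d c) = sum4 X.
  rewrite -sum4_swap_pairs -[RHS]sum4_swap_pairs.
  exact: (sum4_swap (fun a b c d => X c d a b)).
rewrite addnn -mul2n; congr (2 * _).
transitivity (\sum_c \sum_(d in O c :\ c)
    (#|piece c d c| - 1) * (#|piece c d d| * N #|piece c d d|)).
  under [RHS]eq_bigr do rewrite -sum_other_in_cycle.
  apply: eq_sum4_pairs => c d; rewrite /X.
  have [<-|ne_cd] /= := eqVneq c d; first by rewrite !big1 // => a _; rewrite big1.
  have [dc|_] /= := boolP (d \in O c); last by rewrite !big1 // => a _; rewrite big1.
  transitivity (\sum_a \sum_b ((a \in piece c d c :\ c) &&
      (b \in [set b | #|O b| == #|piece c d d|]))).
    by apply: eq_bigr => a _; apply: eq_bigr => b _; rewrite !inE.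
  rewrite sum_mem2 cardsD1_mem ?porbit_id // subn1 mul1n; congr (_ * _).
  rewrite -card_length_class -sum1_card big_mkcond; apply: eq_bigr => b _.
  by rewrite inE; case: eqP.
transitivity (\sum_c \sum_(1 <= k < #|O c|) (#|O c| - k - 1) * (k * N k)).
  by apply: eq_bigr => c _; rewrite (sum_cut s (fun p q => (p - 1) * (q * N q))).
rewrite (sum_cycle_lengths s (fun j => \sum_(1 <= k < j) (j - k - 1) * (k * N k))).
(* Truncated subtraction kills the terms with [j <= i + 1]: the inner range can be extended to a
   square, exchanged, and cut again at [i + 2]. *)
transitivity (\sum_(1 <= j < #|T|.+1) \sum_(1 <= i < #|T|.+1)
    i * j * (j - i - 1) * N i * N j).
  apply: eq_big_nat => j /andP[_ ltj]; rewrite big_distrr /=.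
  rewrite (big_nat_widen _ _ _ _ _ (ltnW ltj)) big_mkcond; apply: eq_bigr => i _ /=.
  case: ltnP => [_|leji].
    by move: (N i) (N j) (j - i - 1) => u v w; nia.
  by rewrite (_ : j - i - 1 = 0) ?muln0 //; lia.
rewrite exchange_big; apply: eq_big_nat => i /andP[i_gt0 lti] /=.
have [lei|] := leqP (i + 2) #|T|.+1.
  rewrite (@big_cat_nat _ _ _ (i + 2)) //=; last by lia.
  rewrite [X in X + _]big_nat big1 // => j /andP[_ ltj].
  by rewrite (_ : j - i - 1 = 0) ?muln0 //; lia.
move=> lti2; rewrite [RHS]big_geq ?(ltnW lti2) // big_nat big1 // => j /andP[_ ltj].
by rewrite (_ : j - i - 1 = 0) ?muln0 //; have := ltn_trans ltj lti2; lia.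
Qed.

Lemma sum_perm_cut p q m : 0 < p -> 0 < q ->
  \sum_(1 <= k < m) (perm_eq [:: m - k; k] [:: p; q] : nat)
  = (m == p + q) * (if p == q then 1 else 2).
Proof.
move=> p_gt0 q_gt0; have [->|ne_m] := eqVneq m (p + q); last first.
  rewrite mul0n big_nat big1 // => k /andP[_ ltk].
  by rewrite perm_eq2; case: (boolP (_ || _)) => //; lia.
transitivity (\sum_(1 <= k < p + q) ((k == q) + (p != q) * (k == p))).
  apply: eq_big_nat => k /andP[k_gt0 ltk]; rewrite perm_eq2.
  by move: ltk k_gt0 p_gt0 q_gt0; clear; lia.
have one r : 0 < r < p + q -> \sum_(1 <= k < p + q) (k == r : nat) = 1.
  move=> rI; rewrite (bigD1_seq r) ?mem_index_iota ?iota_uniq //= eqxx.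
  by rewrite big1 // => k /negbTE->.
rewrite big_split -big_distrr /= !one ?mul1n ?muln1; last 2 first.
- by lia.
- by lia.
by case: eqP.
Qed.

(** For [a], [b] in cycles of lengths i and j, [c] is any point of a cycle of length i + j, and [d]
    has two positions, or one when i = j; [G] records this count. *)
Lemma sum4_two_one_one :
  sum4 (fun a b c d => [&& uniq [:: a; b; c; d], cj a b c d
      & [&& O c == O d, O a != O c, O b != O c & O a != O b]])
  = 4 * (\sum_(1 <= i < #|T|.+1) i ^ 3 * N (2 * i) * 'C(N i, 2)
       + \sum_(1 <= i < #|T|.+1) \sum_(i + 1 <= j < #|T|.+1)
           i * j * (i + j) * N i * N j * N (i + j)).
Proof.
pose G i j := (i + j) * N (i + j) * (if i == j then 1 else 2).
have Gsym i j : G i j = G j i by rewrite /G addnC eq_sym.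
transitivity (\sum_a \sum_b (O a != O b) * G #|O a| #|O b|).
  apply: eq_bigr => a _; apply: eq_bigr => b _.
  under eq_bigr do under eq_bigr do rewrite two_one_one_conj.
  have [_|_] /= := eqVneq (O a) (O b).
    by rewrite big1 // => c _; rewrite big1 // => d _; rewrite !andbF.
  rewrite mul1n /G -card_length_class big_distrl; apply: eq_bigr => c _ /=.
  rewrite -sum_perm_cut ?lt0n ?card_porbit_neq0 //.
  rewrite -(sum_cut s (fun p q => perm_eq [:: p; q] [:: #|O a|; #|O b|] : nat)).
  rewrite -sum_other_in_cycle; apply: eq_bigr => d _.
  by case: (c != d); case: (d \in O c); rewrite ?mul1n ?mul0n.
rewrite (sum_distinct_cycles s Gsym) /G mulnDr; congr (_ + _).
  rewrite big_distrr; apply: eq_bigr => i _; rewrite eqxx addnn -mul2n /=.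
  by move: (N (2 * i)) 'C(_, 2) => u v; rewrite !expnS expn0; nia.
rewrite -[4]/(2 * 2) -mulnA; congr (2 * _).
rewrite big_distrr; apply: eq_bigr => i _; rewrite big_distrr.
apply: eq_big_nat => j /andP[ltij _]; rewrite (_ : (i == j) = false) /=; last by lia.
by move: (N i) (N j) (N (i + j)) => u v w; nia.
Qed.

(** When [i <= j], each [q] admits [p = q] and [p = j - i + q], both below [j] and equal only if
    [i = j]. *)
Lemma sum_two_two i j : 0 < i -> 0 < j ->
  \sum_(1 <= q < i) \sum_(1 <= p < j) ((p == q) || (i + p == j + q) : nat)
  = (if i == j then 1 else 2) * (minn i j - 1).
Proof.
wlog leij : i j / i <= j => [IH|] i_gt0 j_gt0.
  have /orP[leij|leji] := leq_total i j; first exact: IH.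
  rewrite exchange_big minnC eq_sym -IH //; apply: eq_bigr => p _.
  by apply: eq_bigr => q _; rewrite eq_sym [X in _ || X]eq_sym.
rewrite (minn_idPl leij).
have one r : 0 < r < j -> \sum_(1 <= p < j) (p == r : nat) = 1.
  move=> rI; rewrite (bigD1_seq r) ?mem_index_iota ?iota_uniq //= eqxx.
  by rewrite big1 // => k /negbTE->.
rewrite mulnC -sum_nat_const_nat; apply: eq_big_nat => q /andP[q_gt0 ltq].
transitivity (\sum_(1 <= p < j) ((p == q) + (i != j) * (p == j - i + q))).
  apply: eq_big_nat => p _; move: leij ltq q_gt0; clear; lia.
rewrite big_split -big_distrr /= !one ?muln1; last 2 first.
- by lia.
- by lia.
by case: eqP.
Qed.

Lemma sum4_two_two :
  sum4 (fun a b c d => [&& uniq [:: a; b; c; d], cj a b c d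
      & [&& O a == O c, O b == O d & O a != O b]])
  = 4 * (\sum_(2 <= i < #|T|.+1) i * 'C(i, 2) * 'C(N i, 2)
       + \sum_(2 <= i < #|T|.+1) \sum_(i + 1 <= j < #|T|.+1)
           i * (i - 1) * j * N i * N j).
Proof.
pose G i j := (if i == j then 1 else 2) * (minn i j - 1).
have Gsym i j : G i j = G j i by rewrite /G minnC eq_sym.
transitivity (\sum_c \sum_d (O c != O d) * G #|O c| #|O d|).
  apply: eq_sum4_pairs => c d.
  have [ecd|ncd] /= := eqVneq (O c) (O d).
    rewrite big1 // => a _; rewrite big1 // => b _; rewrite ecd.
    have [->|_] := eqVneq (O a) (O d); rewrite ?andbF // eq_sym.
    by case: eqP; rewrite ?andbF.
  have dNc : d \notin O c by rewrite -eq_porbit_mem eq_sym.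
  rewrite mul1n /G -sum_two_two ?lt0n ?card_porbit_neq0 //.
  transitivity (\sum_(a in O c :\ c) \sum_(b in O d :\ d) (cj a b c d : nat)).
    rewrite [RHS]big_mkcond; apply: eq_bigr => a _.
    have aE : (a \in O c :\ c) = (a != c) && (O a == O c).
      by rewrite !inE eq_porbit_mem.
    case: ifPn => [|]; rewrite aE; last first.
      move=> nac; rewrite big1 // => b _.
      apply/eqP; rewrite eqb0; apply: contra nac => /and3P[U _ /and3P[-> _ _]].
      by move: U; rewrite /= !inE !negb_or; case/andP=> /and3P[_ ->].
    case/andP=> ne_ac /eqP eac; rewrite [RHS]big_mkcond; apply: eq_bigr => b _.
    rewrite !inE -eq_porbit_mem eac eqxx /=.
    have [ebd|] := eqVneq (O b) (O d); last by rewrite !andbF.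
    rewrite ebd ncd !andbT.
    have ne x y : O x != O y -> x != y by apply: contraNneq => ->.
    have ne_ab : a != b by apply: ne; rewrite eac ebd.
    have ne_ad : a != d by apply: ne; rewrite eac.
    have ne_bc : b != c by apply: ne; rewrite ebd eq_sym.
    rewrite !negb_or ne_ab ne_ac ne_ad ne_bc (ne c d) // !andbT /=.
    by case: (b != d).
  rewrite big_porbitD1; apply: eq_big_nat => q qI.
  rewrite big_porbitD1; apply: eq_big_nat => p pI.
  by rewrite two_two_conj.
rewrite (sum_distinct_cycles s Gsym) /G mulnDr.
(* A fixed point cannot contain two bad points: the factor [minn i j - 1] vanishes at 1, so the sums
   start at 2. *)
have drop1 (F : nat -> nat) : F 1 = 0 ->
    \sum_(1 <= i < #|T|.+1) F i = \sum_(2 <= i < #|T|.+1) F i.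
  move=> F1; case: #|T| => [|m]; first by rewrite !big_geq.
  by rewrite big_ltn // F1.
congr (_ + _).
  rewrite drop1 ?minnn ?muln0 // big_distrr; apply: eq_bigr => i _.
  rewrite eqxx minnn mul1n; have := mul_bin_diag i 1; rewrite bin1 subn1 /= => e.
  transitivity (2 * i * 'C(N i, 2) * (i * i.-1)); last rewrite e.
    by move: 'C(N i, 2) i.-1; rewrite -mulnn; clear; lia.
  by move: 'C(N i, 2) 'C(i, 2); clear; lia.
rewrite -[4]/(2 * 2) -mulnA; congr (2 * _).
rewrite drop1; last first.
  by rewrite big_nat big1 // => j /andP[ltj _]; rewrite (minn_idPl _) ?muln0 //; lia.
rewrite big_distrr; apply: eq_bigr => i _; rewrite big_distrr.
apply: eq_big_nat => j /andP[ltij _]; rewrite (_ : (i == j) = false) /=; last by lia.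
rewrite (minn_idPl _); last by lia.
by move: (N i) (N j) (i - 1) => u v w; nia.
Qed.

End PatternSums.

(** These two exchanges generate all eight rearrangements of a tuple. *)
Lemma tperm2M_symmetries (T : finType) (s : {perm T}) (a b c d : T)
    (e := fun a b c d => uniq [:: a; b; c; d]
            && (tperm2M s a b c d \in (s ^: [set: {perm T}])%g)) :
  e b a c d = e a b c d /\ e c d a b = e a b c d.
Proof.
rewrite /e; split.
  rewrite /tperm2M (tpermC b); congr (_ && _); apply: perm_uniq.
  by rewrite (perm_catCA [:: b] [:: a]).
have -> : uniq [:: c; d; a; b] = uniq [:: a; b; c; d].
  by apply: perm_uniq; rewrite (perm_catC [:: c; d] [:: a; b]).
by have [/tperm2MC->|] := boolP (uniq [:: a; b; c; d]).
Qed.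

(** * From tuples back to the numbers of commuting permutations *)

Section PatternCounts.
Variables (n : nat) (s : 'S_n).
Local Notation O := (porbit s).
Local Notation N := (cycles_of_length s).
Let e (a b c d : 'I_n) := uniq [:: a; b; c; d]
  && (tperm2M s a b c d \in (s ^: [set: 'S_n])%g).

(** The arguments of [e] are permuted so that each summand is one fixed normal form at a rearranged
    tuple; summed over all tuples, the rearrangements then have equal totals. *)
Lemma tuple_pattern_split a b c d :
  let t := tally_counts (map O [:: a; b; c; d]) in
  [/\ (e a b c d : nat) = (e a b c d && perm_eq t [:: 4])
         + (e a b c d && perm_eq t [:: 3; 1])
         + (e a b c d && perm_eq t [:: 2; 2])
         + (e a b c d && perm_eq t [:: 2; 1; 1]),
      (e a b c d && perm_eq t [:: 3; 1] : nat) =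
        (e a b c d && [&& O a == O c, O c == O d & O a != O b])
        + (e b a c d && [&& O b == O c, O c == O d & O b != O a])
        + (e c d a b && [&& O c == O a, O a == O b & O c != O d])
        + (e d c a b && [&& O d == O a, O a == O b & O d != O c]),
      (e a b c d && perm_eq t [:: 2; 2] : nat) =
        (e a b c d && [&& O a == O c, O b == O d & O a != O b])
        + (e b a c d && [&& O b == O c, O a == O d & O b != O a])
    & (e a b c d && perm_eq t [:: 2; 1; 1] : nat) =
        (e a b c d && [&& O c == O d, O a != O c, O b != O c & O a != O b])
        + (e c d a b && [&& O a == O b, O c != O a, O d != O a & O c != O d])].
Proof.
have [e1 e2] := tperm2M_symmetries s a b c d.
have [e3 _] := tperm2M_symmetries s c d a b.
have -> : e b a c d = e a b c d := e1.
have -> : e c d a b = e a b c d := e2.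
have -> : e d c a b = e a b c d := etrans e3 e2.
apply: pattern_split => /andP[U cj].
  by move=> eab ecd nac; move: cj; rewrite (conj_disjoint_pairs U eab ecd nac).
exact: conj_two_merges.
Qed.

Lemma sum4_pattern ks : sumn ks = 4 ->
  8 * num_part_commuting ks s = #|'C[s]%g| * sum4 (fun a b c d =>
    e a b c d && perm_eq (tally_counts (map O [:: a; b; c; d])) ks).
Proof.
move/num_part_commutingE->; congr (_ * _).
by apply: eq_sum4 => a b c d; rewrite /e andbA.
Qed.

Lemma num_k_commuting_split : num_k_commuting 4 s =
  num_part_commuting [:: 4] s + num_part_commuting [:: 3; 1] s
  + num_part_commuting [:: 2; 2] s + num_part_commuting [:: 2; 1; 1] s.
Proof.
apply/eqP; rewrite -(eqn_pmul2l (isT : 0 < 8)) !mulnDr !sum4_pattern //.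
rewrite -!mulnDr num_k_commutingE -!sum4D; apply/eqP; congr (_ * _).
by apply: eq_sum4 => a b c d; have [-> _ _ _] := tuple_pattern_split a b c d.
Qed.

Lemma num_one_orbit : num_part_commuting [:: 4] s =
  #|'C[s]%g| * \sum_(4 <= i < n.+1) N i * 'C(i, 4).
Proof.
apply/eqP; rewrite -(eqn_pmul2l (isT : 0 < 8)) sum4_pattern // mulnCA.
have := sum4_one_orbit s; rewrite card_ord => <-; apply/eqP; congr (_ * _).
apply: eq_sum4 => a b c d; have [-> _ _ _] := tally_counts4 (O a) (O b) (O c) (O d).
by rewrite /e -andbA.
Qed.

Lemma num_three_one : num_part_commuting [:: 3; 1] s =
  #|'C[s]%g| * \sum_(1 <= i < n.+1) \sum_(i + 2 <= j < n.+1)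
    i * j * (j - i - 1) * N i * N j.
Proof.
apply/eqP; rewrite -(eqn_pmul2l (isT : 0 < 8)) sum4_pattern // mulnCA.
pose X a b c d : nat := e a b c d && [&& O a == O c, O c == O d & O a != O b].
have XE := sum4_three_one s; rewrite card_ord (eq_sum4 (G := X)) in XE; last first.
  by move=> a b c d; rewrite /X /e -andbA.
(* The 4 counts the positions of the point alone in its cycle. *)
rewrite -[8]/(4 * 2) -mulnA -XE; apply/eqP; congr (_ * _).
rewrite (eq_sum4 (G := fun a b c d => X a b c d + X b a c d + X c d a b + X d c a b)).
  rewrite !sum4D (sum4_swap X) (sum4_swap_pairs X).
  rewrite (sum4_swap_pairs (fun a b c d => X b a c d)) sum4_swap.
  by rewrite -!addnA addnn addnA addnn; lia.
by move=> a b c d; have [_ -> _ _] := tuple_pattern_split a b c d.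
Qed.

Lemma num_two_two : num_part_commuting [:: 2; 2] s =
  #|'C[s]%g| * (\sum_(2 <= i < n.+1) i * 'C(i, 2) * 'C(N i, 2)
     + \sum_(2 <= i < n.+1) \sum_(i + 1 <= j < n.+1)
         i * (i - 1) * j * N i * N j).
Proof.
apply/eqP; rewrite -(eqn_pmul2l (isT : 0 < 8)) sum4_pattern // mulnCA.
pose X a b c d : nat := e a b c d && [&& O a == O c, O b == O d & O a != O b].
have XE := sum4_two_two s; rewrite card_ord (eq_sum4 (G := X)) in XE; last first.
  by move=> a b c d; rewrite /X /e -andbA.
(* The 2 records whether [a] shares its cycle with [c] or with [d]. *)
rewrite -[8]/(2 * 4) -mulnA -XE; apply/eqP; congr (_ * _).
rewrite (eq_sum4 (G := fun a b c d => X a b c d + X b a c d)).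
  by rewrite sum4D (sum4_swap X) addnn mul2n.
by move=> a b c d; have [_ _ -> _] := tuple_pattern_split a b c d.
Qed.

Lemma num_two_one_one : num_part_commuting [:: 2; 1; 1] s =
  #|'C[s]%g| * (\sum_(1 <= i < n.+1) i ^ 3 * N (2 * i) * 'C(N i, 2)
     + \sum_(1 <= i < n.+1) \sum_(i + 1 <= j < n.+1)
         i * j * (i + j) * N i * N j * N (i + j)).
Proof.
apply/eqP; rewrite -(eqn_pmul2l (isT : 0 < 8)) sum4_pattern // mulnCA.
pose X a b c d : nat :=
  e a b c d && [&& O c == O d, O a != O c, O b != O c & O a != O b].
have XE := sum4_two_one_one s; rewrite card_ord (eq_sum4 (G := X)) in XE; last first.
  by move=> a b c d; rewrite /X /e -andbA.
(* The 2 records which of the two pairs lies inside one cycle. *)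
rewrite -[8]/(2 * 4) -mulnA -XE; apply/eqP; congr (_ * _).
rewrite (eq_sum4 (G := fun a b c d => X a b c d + X c d a b)).
  by rewrite sum4D (sum4_swap_pairs X) addnn mul2n.
by move=> a b c d; have [_ _ _ ->] := tuple_pattern_split a b c d.
Qed.

End PatternCounts.

(** Indices beyond [n] are covered because [2 * i] and [i + j] may exceed [n] in the formulas; [c 0]
    is left free by the cycle type, hence [0 < i]. *)
Lemma cycle_type_lengths (n : nat) (beta : 'S_n) (c : nat -> nat) i :
  has_cycle_type beta c -> 0 < i -> c i = cycles_of_length beta i.
Proof.
move=> [c_small c_big] i_gt0; have [lein|ltni] := leqP i n.
  by rewrite c_small ?i_gt0.
rewrite c_big // /cycles_of_length (_ : [set B in _ | _] = set0) ?cards0 //.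
apply/setP=> B; rewrite !inE; apply/negbTE/nandP; right.
by rewrite neq_ltn (leq_ltn_trans (max_card _)) // card_ord.
Qed.

Theorem theorem6 (n : nat) (beta : 'S_n) (c : nat -> nat)
    (hc : has_cycle_type beta c) :
  num_k_commuting 4 beta =
    num_part_commuting [:: 4] beta + num_part_commuting [:: 3; 1] beta
    + num_part_commuting [:: 2; 2] beta + num_part_commuting [:: 2; 1; 1] beta
  /\ num_part_commuting [:: 4] beta =
    #|'C[beta]%g| * \sum_(4 <= i < n.+1) c i * 'C(i, 4)
  /\ num_part_commuting [:: 3; 1] beta =
    #|'C[beta]%g| *
      \sum_(1 <= i < n.+1) \sum_(i + 2 <= j < n.+1)
        i * j * (j - i - 1) * c i * c j
  /\ num_part_commuting [:: 2; 2] beta =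
    #|'C[beta]%g| *
      (\sum_(2 <= i < n.+1) i * 'C(i, 2) * 'C(c i, 2)
       + \sum_(2 <= i < n.+1) \sum_(i + 1 <= j < n.+1)
           i * (i - 1) * j * c i * c j)
  /\ num_part_commuting [:: 2; 1; 1] beta =
    #|'C[beta]%g| *
      (\sum_(1 <= i < n.+1) i ^ 3 * c (2 * i) * 'C(c i, 2)
       + \sum_(1 <= i < n.+1) \sum_(i + 1 <= j < n.+1)
           i * j * (i + j) * c i * c j * c (i + j)).
Proof.
have cE i : 0 < i -> c i = cycles_of_length beta i := cycle_type_lengths hc.
split; first exact: num_k_commuting_split.
rewrite num_one_orbit num_three_one num_two_two num_two_one_one.
split; [|split; [|split]]; congr (_ * _).
- by apply: eq_big_nat => i /andP[i_ge _]; rewrite cE // (leq_trans _ i_ge).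
- apply: eq_big_nat => i /andP[i_ge _]; apply: eq_big_nat => j /andP[j_ge _].
  by rewrite !cE // (leq_trans _ j_ge) // addn2.
- congr (_ + _); apply: eq_big_nat => i /andP[i_ge _].
    by rewrite cE // ltnW.
  apply: eq_big_nat => j /andP[j_ge _].
  by rewrite !cE ?(ltnW i_ge) // (leq_trans _ j_ge) // addn1.
congr (_ + _); apply: eq_big_nat => i /andP[i_ge _].
  by rewrite !cE // muln_gt0.
apply: eq_big_nat => j /andP[j_ge _].
by rewrite !cE // ?addn_gt0 ?i_ge // (leq_trans _ j_ge) // addn1.
Qed.
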